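(* Let $d\geq 1$. If an analytic set $\mathscr{A}\subseteq (0,1)^{d}$ cannot be covered by an $F_{\sigma}$, purely unrectifiable set, then a typical $f\in\operatorname{Lip}_{1}([0,1]^{d})$ has points of differentiability in $\mathscr{A}$; moreover, for a typical $f$ such a point $x\in\mathscr{A}$ may be taken so that $f$ is differentiable at $x$ with $\|\nabla f(x)\|=1$. That is, the set of $f\in\operatorname{Lip}_1([0,1]^d)$ for which there exists $x\in\mathscr{A}$ such that $f$ is differentiable at $x$ with $\|\nabla f(x)\|=1$ is residual in $\operatorname{Lip}_1([0,1]^d)$.
   Context: $\operatorname{Lip}_{1}([0,1]^{d})$ denotes the set of all functions $f\colon[0,1]^d\to\mathbb{R}$ with Lipschitz constant at most $1$, viewed as a complete metric space with the supremum metric. ''Typical'' means: the set of functions with the property is residual (complement meagre). A Lipschitz curve is a Lipschitz map $\gamma\colon I\to\mathbb{R}^d$, $I\subseteq\mathbb{R}$ a closed interval, whose derivative is bounded away from zero in norm almost everywhere. A set $P\subseteq\mathbb{R}^d$ is purely unrectifiable if for every Lipschitz curve $\gamma\colon[0,1]\to\mathbb{R}^d$ the set $\gamma^{-1}(P)$ has Lebesgue measure zero. *)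

(* Defs.v *)
From HB Require Import structures.
From mathcomp Require Import all_boot all_order all_algebra.
From mathcomp Require Import all_classical all_reals.
From mathcomp Require Import topology normedtype measure lebesgue_measure.
From mathcomp Require Import Rstruct Rstruct_topology.
From Stdlib Require Import Rdefinitions.

Unset Printing Implicit Defensive.

Import Order.TTheory GRing.Theory Num.Theory.
Local Open Scope classical_set_scope.
Local Open Scope ring_scope.

Notation pt d := 'rV[R]_d.

Definition dotp {d : nat} (u v : pt d) : R := \sum_(i < d) u ord0 i * v ord0 i.
Definition enorm {d : nat} (u : pt d) : R := Num.sqrt (dotp u u).

Definition cube (d : nat) : set (pt d) :=
  [set x | forall i : 'I_d, 0 <= x ord0 i <= 1].
Definition open_cube (d : nat) : set (pt d) :=
  [set x | forall i : 'I_d, 0 < x ord0 i < 1].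

(* Lip_1([0,1]^d): functions whose restriction to [0,1]^d is 1-Lipschitz
   (Euclidean norm).  Only the values on [0,1]^d matter. *)
Definition Lip1 (d : nat) : set (pt d -> R) :=
  [set f | forall x y, cube d x -> cube d y -> `|f x - f y| <= enorm (x - y)].

Definition supdist_lt (d : nat) (f g : pt d -> R) (r : R) : Prop :=
  exists2 r' : R, r' < r & forall x, cube d x -> `|f x - g x| <= r'.

Definition lip_closure (d : nat) (S : set (pt d -> R)) : set (pt d -> R) :=
  [set g | Lip1 d g /\ forall e : R, 0 < e ->
     exists h, [/\ Lip1 d h, S h & supdist_lt d g h e]].

Definition lip_nowhere_dense (d : nat) (S : set (pt d -> R)) : Prop :=
  ~ exists f : pt d -> R, exists2 r : R, 0 < r /\ Lip1 d f &
      (forall g, Lip1 d g -> supdist_lt d f g r -> lip_closure d S g).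

Definition lip_meagre (d : nat) (S : set (pt d -> R)) : Prop :=
  exists N : nat -> set (pt d -> R),
    (forall n, lip_nowhere_dense d (N n)) /\
    (forall f, Lip1 d f -> S f -> exists n, N n f).

Definition lip_residual (d : nat) (S : set (pt d -> R)) : Prop :=
  lip_meagre d [set f | ~ S f].

Definition has_gradient (d : nat) (f : pt d -> R) (x v : pt d) : Prop :=
  forall e : R, 0 < e -> exists2 delta : R, 0 < delta &
    forall y, enorm (y - x) < delta ->
      `|f y - f x - dotp v (y - x)| <= e * enorm (y - x).

Definition eclosed (d : nat) (C : set (pt d)) : Prop :=
  forall x, (forall e : R, 0 < e -> exists y, C y /\ enorm (x - y) < e) -> C x.

Definition Fsigma (d : nat) (P : set (pt d)) : Prop :=
  exists C : nat -> set (pt d), (forall n, eclosed d (C n)) /\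
    P = \bigcup_n C n.

Definition baire_continuous (d : nat) (g : (nat -> nat) -> pt d) : Prop :=
  forall s : nat -> nat, forall e : R, 0 < e -> exists n : nat,
    forall t : nat -> nat, (forall k : nat, ltn k n -> t k = s k) ->
      enorm (g t - g s) < e.

Definition analytic (d : nat) (A : set (pt d)) : Prop :=
  A = set0 \/ exists g : (nat -> nat) -> pt d,
    baire_continuous d g /\ A = range g.

Definition curve_deriv (d : nat) (gamma : R -> pt d) (t : R) (v : pt d) : Prop :=
  forall e : R, 0 < e -> exists2 delta : R, 0 < delta &
    forall h : R, 0 < `|h| < delta ->
      enorm (h^-1 *: (gamma (t + h) - gamma t) - v) <= e.

Definition lipschitz_curve (d : nat) (gamma : R -> pt d) : Prop :=
  (exists L : R, forall s t : R, `[0, 1]%classic s -> `[0, 1]%classic t ->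
     enorm (gamma s - gamma t) <= L * `|s - t|) /\
  (exists2 c : R, 0 < c &
     (@lebesgue_measure R).-negligible
       (`[0, 1]%classic `\` [set t | exists v, curve_deriv d gamma t v /\ c <= enorm v])).

Definition purely_unrectifiable (d : nat) (P : set (pt d)) : Prop :=
  forall gamma : R -> pt d, lipschitz_curve d gamma ->
    (@lebesgue_measure R).-negligible (`[0, 1]%classic `&` (gamma @^-1` P)).

(* Main.v *)
Require Import Defs.
From mathcomp Require Import all_boot all_order all_algebra.
From mathcomp Require Import all_classical all_reals.
From mathcomp Require Import Rstruct.
From Stdlib Require Import Rdefinitions.
From mathcomp Require Import topology normedtype measure lebesgue_measure.
From mathcomp Require Import measurable_realfun ereal numfun lebesgue_integral.
From mathcomp Require Import Rstruct_topology ring lra zify.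
Import numFieldNormedType.Exports.
Import Order.TTheory GRing.Theory Num.Theory.
Local Delimit Scope nat_scope with N.
Local Open Scope classical_set_scope.
Local Open Scope ring_scope.

(** Call a closed set small relative to a set [D] of velocities if every Lipschitz curve spends
almost no time in it while moving with velocity in [D].  Splitting [D] into finitely many narrow
cones, and removing from [A = g (nat -> nat)] the cylinders whose images are covered by countably
many small closed sets, one always finds a piece of [A], of arbitrarily small diameter, and a
narrow cone of directions such that the closure of every portion of the piece meets some curve
with directions in the cone in positive measure.

The second player of the Banach-Mazur game in [Lip1] uses this as follows.  Suppose that near the
current piece all remaining functions are close to an affine function with unit gradient [e].
Along a short curve fragment in the closure of the piece, with directions nearly [e] and with high
density, such a function [f] grows at almost the maximal rate, so by the rising sun lemma some
point [x] of the fragment has, at all scales, increments of almost maximal slope in the directions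
[e] and [- e].  A 1-Lipschitz function with this property is nearly affine around [x] at all these
scales.  Moving [f] towards the affine function through [x] by at most [eta] makes it exactly
affine near [x] without spoiling the approximation elsewhere; then the piece and the cone are
refined.  The pieces shrink to a point of [A], the axes of the cones converge to a unit vector,
and every function compatible with the play has that vector as its gradient at that point. *)

(** * Euclidean norm *)

Lemma dotpC (d : nat) (u v : pt d) : dotp u v = dotp v u.
Proof. by apply: eq_bigr => i _; rewrite mulrC. Qed.

Lemma dotpDl (d : nat) (u v w : pt d) : dotp (u + v) w = dotp u w + dotp v w.
Proof. by rewrite -big_split; apply: eq_bigr => i _; rewrite mxE mulrDl. Qed.

Lemma dotpZl (d : nat) (a : R) (u w : pt d) : dotp (a *: u) w = a * dotp u w.
Proof. by rewrite mulr_sumr; apply: eq_bigr => i _; rewrite mxE mulrA. Qed.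

Lemma dotpDr (d : nat) (u v w : pt d) : dotp w (u + v) = dotp w u + dotp w v.
Proof. by rewrite dotpC dotpDl !(dotpC _ w). Qed.

Lemma dotpZr (d : nat) (a : R) (u w : pt d) : dotp w (a *: u) = a * dotp w u.
Proof. by rewrite dotpC dotpZl dotpC. Qed.

Lemma dotpNl (d : nat) (u w : pt d) : dotp (- u) w = - dotp u w.
Proof. by rewrite -scaleN1r dotpZl mulN1r. Qed.

Lemma dotpNr (d : nat) (u w : pt d) : dotp w (- u) = - dotp w u.
Proof. by rewrite dotpC dotpNl dotpC. Qed.

Lemma dotp_ge0 (d : nat) (u : pt d) : 0 <= dotp u u.
Proof. by apply: sumr_ge0 => i _; rewrite -expr2 sqr_ge0. Qed.

Lemma enorm_ge0 (d : nat) (u : pt d) : 0 <= enorm u.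
Proof. exact: sqrtr_ge0. Qed.

Lemma sqr_enorm (d : nat) (u : pt d) : enorm u ^+ 2 = dotp u u.
Proof. by rewrite sqr_sqrtr // dotp_ge0. Qed.

Lemma enorm0 (d : nat) : enorm (0 : pt d) = 0.
Proof. by rewrite /enorm /dotp big1 ?sqrtr0 // => i _; rewrite mxE mul0r. Qed.

Lemma enorm_eq0 (d : nat) (u : pt d) : enorm u = 0 -> u = 0.
Proof.
move=> u0; have : dotp u u = 0 by rewrite -sqr_enorm u0 expr0n.
rewrite /dotp => /psumr_eq0P h; apply/rowP => i; rewrite mxE.
have h0 : forall j : 'I_d, true -> 0 <= u ord0 j * u ord0 j.
  by move=> j _; rewrite -expr2 sqr_ge0.
by have /eqP := h h0 i isT; rewrite mulf_eq0 orbb => /eqP.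
Qed.

Lemma cauchy_schwarz (d : nat) (u v : pt d) : dotp u v <= enorm u * enorm v.
Proof.
have [a0 b0] := (enorm_ge0 _ u, enorm_ge0 _ v).
have [u0|u0] := eqVneq (enorm u) 0.
  by rewrite (enorm_eq0 _ _ u0) enorm0 mul0r -(scale0r 0) dotpZl mul0r.
have [v0|v0] := eqVneq (enorm v) 0.
  by rewrite (enorm_eq0 _ _ v0) enorm0 mulr0 -(scale0r 0) dotpZr mul0r.
have := dotp_ge0 _ (enorm v *: u - enorm u *: v).
rewrite dotpDl !dotpDr !dotpNl !dotpNr !dotpZl !dotpZr -!sqr_enorm (dotpC _ v u).
have : 0 < enorm u * enorm v by rewrite mulr_gt0 // lt0r ?u0 ?v0.
move: (enorm u) (enorm v) (dotp u v) => a b c; nra.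
Qed.

Lemma enormN (d : nat) (u : pt d) : enorm (- u) = enorm u.
Proof. by rewrite /enorm dotpNl dotpNr opprK. Qed.

Lemma normr_dotp (d : nat) (u v : pt d) : `|dotp u v| <= enorm u * enorm v.
Proof.
rewrite ler_norml cauchy_schwarz andbT.
by have := cauchy_schwarz _ (- u) v; rewrite dotpNl enormN; lra.
Qed.

Lemma enorm_distC (d : nat) (u v : pt d) : enorm (u - v) = enorm (v - u).
Proof. by rewrite -enormN opprB. Qed.

Lemma enormZ (d : nat) (a : R) (u : pt d) : enorm (a *: u) = `|a| * enorm u.
Proof. by rewrite /enorm dotpZl dotpZr mulrA sqrtrM ?sqr_ge0// -expr2 sqrtr_sqr. Qed.

Lemma enormD (d : nat) (u v : pt d) : enorm (u + v) <= enorm u + enorm v.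
Proof.
rewrite -(@ler_pXn2r _ 2) ?nnegrE ?addr_ge0 ?enorm_ge0 //.
rewrite sqr_enorm dotpDl !dotpDr -!sqr_enorm (dotpC _ v u).
have := cauchy_schwarz _ u v; nra.
Qed.

Lemma enorm_triangle (d : nat) (w u v : pt d) :
  enorm (u - v) <= enorm (u - w) + enorm (w - v).
Proof. by have := enormD _ (u - w) (w - v); rewrite addrA subrK. Qed.

Lemma coord_le_enorm (d : nat) (u : pt d) (i : 'I_d) : `|u ord0 i| <= enorm u.
Proof.
rewrite -(@ler_pXn2r _ 2) ?nnegrE ?enorm_ge0 // sqr_enorm /dotp (bigD1 i) //=.
rewrite real_normK ?num_real // -expr2 lerDl.
by apply: sumr_ge0 => j _; rewrite -expr2 sqr_ge0.
Qed.

Lemma enorm_le_coords (d : nat) (u : pt d) (m : R) :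
  (forall i, `|u ord0 i| <= m) -> enorm u <= d%:R * m.
Proof.
case: d u => [|d] u um.
  by rewrite mul0r /enorm /dotp big_ord0 sqrtr0.
have m0 : 0 <= m by apply: le_trans (normr_ge0 _) (um ord0).
rewrite -(@ler_pXn2r _ 2) ?nnegrE ?enorm_ge0 ?mulr_ge0 // sqr_enorm.
apply: (@le_trans _ _ (\sum_(i < d.+1) m ^+ 2)).
  by apply: ler_sum => i _; rewrite -expr2 -(real_normK (num_real _)) ler_pXn2r ?nnegrE.
rewrite sumr_const card_ord -[leLHS]mulr_natl exprMn ler_wpM2r ?sqr_ge0 //.
by rewrite -natrX ler_nat expnS expn1 leq_pmull.
Qed.

Lemma enorm_sub_le1 (d : nat) (u v : pt d) : `|enorm u - enorm v| <= enorm (u - v).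
Proof.
rewrite ler_norml; apply/andP; split.
  have := enormD _ u (v - u); rewrite addrC subrK (enorm_distC _ v u); lra.
have := enormD _ v (u - v); rewrite addrC subrK; lra.
Qed.

(** * Extension from the cube to the whole space *)

Definition lip_global (d : nat) (f : pt d -> R) : Prop :=
  forall x y, `|f x - f y| <= enorm (x - y).

Definition clamp (d : nat) (x : pt d) : pt d :=
  \row_i Num.min 1 (Num.max 0 (x ord0 i)).

Lemma clamp_cube (d : nat) (x : pt d) : cube d (clamp d x).
Proof. by move=> i; rewrite mxE; rewrite le_min ge_min le_max ler01 !lexx. Qed.

Lemma clamp_id (d : nat) (x : pt d) : cube d x -> clamp d x = x.
Proof. by move=> cx; apply/rowP => i; rewrite mxE; have /andP[? ?] := cx i;
  rewrite max_r ?min_r. Qed.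

Lemma enorm_clamp (d : nat) (x y : pt d) :
  enorm (clamp d x - clamp d y) <= enorm (x - y).
Proof.
rewrite ler_sqrt ?dotp_ge0 //; apply: ler_sum => i _.
rewrite !mxE -!expr2 -(real_normK (num_real (Num.min _ _ - _))).
rewrite -(real_normK (num_real (x _ _ - _))) ler_pXn2r ?nnegrE //.
move: (x _ _) (y _ _) => a b.
have := ler_norm (a - b); have := ler_norm (b - a); rewrite (distrC b a) ler_norml.
move: (`|a - b|) => n ? ?; case: (lerP 1 (Num.max 0 a)); case: (lerP 1 (Num.max 0 b));
  case: (lerP 0 a); case: (lerP 0 b) => *; apply/andP; split; lra.
Qed.

(** [clamp] is the nearest-point projection onto the cube; it does not increase distances and fixes
    the cube, so this extends [f] with its Lipschitz constant. *)
Lemma lip_global_clamp (d : nat) (f : pt d -> R) :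
  Lip1 d f -> lip_global d (f \o clamp d).
Proof.
move=> lf x y; apply: le_trans (enorm_clamp d x y).
by apply: lf; exact: clamp_cube.
Qed.

(** * Points of almost maximal growth *)

(** Discrete rising sun lemma, scanning from the left: a good index is skipped by monotonicity; from
    a bad one the scan jumps to its [j], and on the stretch jumped over [w] gains more than [lam]
    per index, whether bad or not. *)
Lemma rising_sun_right (N : nat) (w : nat -> R) (lam : R) (bad : pred nat) :
  0 < lam -> (forall i, (i < N)%N -> w i <= w i.+1) ->
  (forall i, bad i -> exists j, (i < j <= N)%N /\ lam * (j%:R - i%:R) < w j - w i) ->
  forall k m : nat, (m + k = N)%N ->
  lam * (count bad (iota m k))%:R <= w N - w m.
Proof.
move=> lam0 wmono badP; elim/ltn_ind => -[_ m|k IH m mkN].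
  by rewrite addn0 => ->; rewrite mulr0 subrr.
have [bm|nbm] := boolP (bad m); last first.
  rewrite /= (negbTE nbm) add0n.
  have := IH k (ltnSn k) m.+1; rewrite addSnnS => /(_ mkN).
  have : (m < N)%N by rewrite -mkN addnS ltnS leq_addr.
  by move=> /wmono; lra.
have [j [/andP[mj jN] wj]] := badP m bm.
have kE : k.+1 = ((j - m) + (N - j))%N. by lia.
have /IH : (N - j < k.+1)%N by lia.
move=> /(_ j (subnKC jN)) h.
rewrite kE iotaD count_cat subnKC; last exact: ltnW.
have : (count bad (iota m (j - m)))%:R <= j%:R - m%:R :> R.
  rewrite -natrB; last exact: ltnW.
  by rewrite ler_nat (leq_trans (count_size _ _)) // size_iota.
rewrite natrD mulrDr; nra.
Qed.

(** The mirror image, scanning from the right. The last index [m] is counted as well, since a jump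
    from [m] lands on [j], which may itself be bad. *)
Lemma rising_sun_left (w : nat -> R) (lam : R) (bad : pred nat) :
  0 < lam -> (forall i, bad i -> exists j, (j < i)%N /\ lam * (i%:R - j%:R) < w i - w j) ->
  forall m : nat, (forall i, (i < m)%N -> w i <= w i.+1) ->
  lam * (count bad (iota 0 m.+1))%:R <= w m - w 0%N.
Proof.
move=> lam0 badP; elim/ltn_ind => m IH wmono.
have [bm|nbm] := boolP (bad m); last first.
  case: m IH wmono nbm => [|m] IH wmono nbm.
    by rewrite /= (negbTE nbm) mulr0 subrr.
  rewrite -addn1 iotaD count_cat add0n /= (negbTE nbm) !addn0.
  have := IH m (ltnSn m) (fun i im => wmono i (ltnW im)).
  by have := wmono m (ltnSn m); rewrite /=; lra.
have [j [jm wj]] := badP m bm.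
have := IH j jm (fun i ij => wmono i (ltn_trans ij jm)).
have -> : m.+1 = (j.+1 + (m - j))%N by rewrite addSn subnKC // ltnW.
rewrite [in X in _ -> X]iotaD count_cat natrD mulrDr.
have : (count bad (iota (0 + j.+1) (m - j)))%:R <= m%:R - j%:R :> R.
  rewrite -natrB; last exact: ltnW.
  by rewrite ler_nat (leq_trans (count_size _ _)) // size_iota.
nra.
Qed.

(** Of the [4 * n] indices at most [n / 4] are bad to the right, [n / 4] bad to the left and [n / 2]
    stale, together fewer than the [2 * n] indices of the middle half. The middle half leaves room
    on both sides. *)
Lemma middle_good_index (n : nat) (W : nat -> R) (stale : pred nat) (lam : R) :
  (0 < n)%N -> 0 < lam ->
  (forall i, (i < 4 * n)%N -> W i <= W i.+1) ->
  16 * (W (4 * n)%N - W 0%N) <= lam * (4 * n)%:R ->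
  8 * (count stale (iota 0 (4 * n)))%:R <= (4 * n)%:R :> R ->
  exists i, [/\ (n <= i < 3 * n)%N, ~~ stale i,
    forall j, (i <= j <= 4 * n)%N -> W j - W i <= lam * (j%:R - i%:R) &
    forall j, (j <= i)%N -> W i - W j <= lam * (i%:R - j%:R)].
Proof.
move=> n0 lam0 Wmono Wtot stot.
pose br i := `[< exists j, (i < j <= 4 * n)%N /\ lam * (j%:R - i%:R) < W j - W i >].
pose bl i := `[< exists j, (j < i)%N /\ lam * (i%:R - j%:R) < W i - W j >].
have brP i : (exists j, (i < j <= 4 * n)%N /\ lam * (j%:R - i%:R) < W j - W i) -> br i.
  by move=> h; rewrite /br; exact: asboolT.
have blP i : (exists j, (j < i)%N /\ lam * (i%:R - j%:R) < W i - W j) -> bl i.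
  by move=> h; rewrite /bl; exact: asboolT.
have Cr := rising_sun_right (4 * n) W lam br lam0 Wmono
  (fun i (h : is_true (`[< _ >])) => asboolW h) (4 * n) 0 erefl.
have Cl := rising_sun_left W lam bl lam0
  (fun i (h : is_true (`[< _ >])) => asboolW h) (4 * n) Wmono.
have [|allbad] := pselect (exists2 i, (n <= i < 3 * n)%N & ~~ [|| stale i, br i | bl i]).
  move=> [i ni]; rewrite 2!negb_or => /and3P[si bri bli].
  exists i; split => // j.
    move=> /andP[ij jn]; rewrite leNgt; apply/negP => h.
    move: ij; rewrite leq_eqVlt => /orP[/eqP ij|ij].
      by move: h; rewrite ij !subrr mulr0 ltxx.
    by apply: (negP bri); apply: brP; exists j; rewrite ij.
  move=> ji; rewrite leNgt; apply/negP => h.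
  move: ji; rewrite leq_eqVlt => /orP[/eqP ij|ij].
    by move: h; rewrite ij !subrr mulr0 ltxx.
  by apply: (negP bli); apply: blP; exists j.
exfalso.
have sub (p : pred nat) : (count p (iota n (2 * n)) <= count p (iota 0 (4 * n)))%N.
  have -> : (4 * n = n + (2 * n + n))%N by lia.
  by rewrite iotaD [X in count _ (_ ++ X)]iotaD !count_cat add0n addnCA leq_addr.
have subl : (count bl (iota 0 (4 * n)) <= count bl (iota 0 (4 * n).+1))%N.
  by rewrite -[(4 * n).+1]addn1 iotaD count_cat leq_addr.
have : (2 * n <= count stale (iota 0 (4 * n)) + count br (iota 0 (4 * n))
   + count bl (iota 0 (4 * n).+1))%N.
  have c2 : count (predU stale (predU br bl)) (iota n (2 * n)) = (2 * n)%N.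
    apply/eqP; rewrite -[eqbRHS](size_iota n) -all_count; apply/allP => i.
    rewrite mem_iota => /andP[ni in3]; apply/negPn/negP => h; apply: allbad.
    by exists i => //; rewrite ni /= mulSn.
  have cU (T : Type) (p q : pred T) s : (count (predU p q) s <= count p s + count q s)%N.
    by rewrite -count_predUI leq_addr.
  have := cU _ stale (predU br bl) (iota n (2 * n)).
  have := cU _ br bl (iota n (2 * n)).
  have := sub stale; have := sub br; have := leq_trans (sub bl) subl.
  by rewrite c2; lia.
rewrite -(ler_nat R) natrM 2!natrD.
move: Cr Cl Wtot stot; rewrite !natrM.
set a := (count br (iota _ _))%:R; set b := (count bl (iota _ _))%:R.
set c := (count stale (iota _ _))%:R.
move=> Cr Cl Wtot stot habc.
have n1 : 0 < n%:R :> R by rewrite ltr0n.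
have ha : 16 * a <= 4 * n%:R by rewrite -(ler_pM2l lam0); lra.
have hb : 16 * b <= 4 * n%:R by rewrite -(ler_pM2l lam0); lra.
lra.
Qed.

Lemma lip_le (d : nat) (f : pt d -> R) (x y : pt d) :
  lip_global d f -> f x <= f y + enorm (x - y).
Proof. by move=> lf; have := le_trans (ler_norm _) (lf x y); lra. Qed.

Definition cell_hit (K : set R) (N i : nat) : Prop :=
  exists t, [/\ K t, i%:R / N%:R <= t & t <= i.+1%:R / N%:R].

(** A counting substitute for density in measure: at every scale, [K] misses at most a proportion
    [kap] of the cells. *)
Definition cell_dense (K : set R) (kap : R) : Prop :=
  forall N : nat, (0 < N)%N ->
    (count (fun i => ~~ `[< cell_hit K N i >]) (iota 0 N))%:R <= kap * N%:R.

(** The deficit of [f] along the curve from the maximal growth rate has small total, so the rising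
    sun lemma yields a time in [K] around which it is small at all scales. Near such a time the
    curve follows the line in direction [e], to which the increments are transferred. The error [xi]
    pays for the discretisation. *)
Lemma lip_steep_point (d : nat) (f : pt d -> R) (e : pt d) (gam : R -> pt d)
    (K : set R) (l L eps th kap lam xi : R) :
  lip_global d f -> enorm e = 1 -> 0 < l -> 0 <= L -> 0 <= eps <= 1 -> lam <= 1 ->
  (forall t s, K t -> 0 <= t <= 1 -> 0 <= s <= 1 ->
     enorm (gam s - gam t - ((s - t) * l) *: e) <= eps * l * `|s - t|) ->
  (forall t s, 0 <= t <= 1 -> 0 <= s <= 1 -> enorm (gam s - gam t) <= L * l * `|s - t|) ->
  cell_dense K kap ->
  (1 - th) * l <= f (gam 1) - f (gam 0) ->
  0 < lam -> 16 * (eps + th + L * kap) <= lam -> 8 * kap <= 1 -> 0 < xi ->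
  exists t, [/\ K t, 0 <= t <= 1 & forall r, 0 <= r <= l / 8 ->
    f (gam t) + (1 - lam - eps) * r - xi <= f (gam t + r *: e) /\
    f (gam t - r *: e) <= f (gam t) - (1 - lam - eps) * r + xi].
Proof.
move=> lf e1 l0 L0 /andP[eps0 eps1] lam1 gamK gamL Kden steep lam0 lam16 kap8 xi0.
(* The mesh is so fine that [6 * (l / N)] is at most [xi], which absorbs all rounding to grid points
   below. *)
pose n := (Num.truncn (6 * l / xi)).+1.
pose N := (4 * n)%N.
have N0 : (0 < N)%N by rewrite muln_gt0.
have NR : 0 < N%:R :> R by rewrite ltr0n.
have NlX : 6 * l <= xi * N%:R.
  have : 6 * l / xi < n%:R by apply: truncnS_gt.
  rewrite ltr_pdivrMr // natrM mulrC.
  have : 0 <= xi * n%:R by rewrite mulr_ge0 ?ler0n // ltW.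
  move: (n%:R) => y; nra.
pose p (i : nat) : R := i%:R / N%:R.
have pN (i : nat) : p i * N%:R = i%:R by rewrite mulfVK // gt_eqF.
have p01 (i : nat) : (i <= N)%N -> 0 <= p i <= 1.
  by move=> iN; rewrite divr_ge0 //= ler_pdivrMr // mul1r ler_nat.
have pS (i : nat) : p i.+1 = p i + N%:R^-1 by rewrite /p -natr1 mulrDl mul1r.
pose u i := f (gam (p i)).
pose stale i := ~~ `[< cell_hit K N i >].
(* Across a cell missed by [K] only the crude bound [L] is available: the last term of [W] pays
   for it, making [W] monotone. *)
pose W i := (1 + eps) * i%:R - u i * N%:R / l + L * (count stale (iota 0 i))%:R.
have kap0 : 0 <= kap.
  by rewrite -(@pmulr_lge0 _ N%:R) //; apply: le_trans (Kden N N0).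
have nearK t s : K t -> 0 <= t <= 1 -> 0 <= s <= 1 ->
    enorm (gam s - gam t) <= (1 + eps) * l * `|s - t|.
  move=> Kt t01 s01; have := gamK t s Kt t01 s01.
  have := enormD _ (gam s - gam t - ((s - t) * l) *: e) (((s - t) * l) *: e).
  by rewrite subrK enormZ e1 mulr1 normrM (gtr0_norm l0); nra.
have cS i : count stale (iota 0 i.+1) = (count stale (iota 0 i) + stale i)%N.
  by rewrite -[in LHS](addn1 i) iotaD count_cat add0n /= addn0.
have Nl0 : 0 < N%:R / l by rewrite divr_gt0.
have uS i : (i < N)%N -> (u i.+1 - u i) * (N%:R / l) <= 1 + eps + L * (stale i)%:R.
  move=> iN; have := p01 i (ltnW iN); have := p01 i.+1 iN => pS01 pi01.
  have lN : l / N%:R * (N%:R / l) = 1.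
    by rewrite mulrA mulfVK ?mulfV // gt_eqF.
  suff : u i.+1 - u i <= (1 + eps + L * (stale i)%:R) * (l / N%:R).
    rewrite -(ler_pM2r Nl0) -[X in _ <= X]mulrA lN mulr1 => h; exact: h.
  have ui := lip_le _ _ (gam (p i.+1)) (gam (p i)) lf.
  rewrite /u; case: (boolP (stale i)) => [_|].
    have := gamL (p i) (p i.+1) pi01 pS01.
    rewrite pS addrAC subrr add0r ger0_norm ?invr_ge0 ?ler0n // mulr1.
    have : 0 <= (1 + eps) * (l / N%:R).
      by apply: mulr_ge0; [lra|rewrite divr_ge0 ?ler0n // ltW].
    by move: ui; rewrite pS; lra.
  move=> /negPn/asboolW[t [Kt]]; rewrite -/(p i) -/(p i.+1) mulr0 addr0 => pt tp.
  have t01 : 0 <= t <= 1 by lra.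
  have := nearK t (p i) Kt t01 pi01; have := nearK t (p i.+1) Kt t01 pS01.
  rewrite [`|p i.+1 - t|]ger0_norm ?subr_ge0 // [`|p i - t|]ler0_norm ?subr_le0 //.
  have := enorm_triangle _ (gam t) (gam (p i.+1)) (gam (p i)).
  rewrite (enorm_distC _ (gam t)); move: ui; rewrite pS; lra.
have Wmono i : (i < N)%N -> W i <= W i.+1.
  by move=> /uS; rewrite /W cS natrD -natr1; lra.
have staletot : (count stale (iota 0 N))%:R <= kap * N%:R by exact: Kden.
have Wtot : 16 * (W N - W 0%N) <= lam * N%:R.
  have : (1 - th) * N%:R <= (u N - u 0%N) * (N%:R / l).
    have -> : (1 - th) * N%:R = ((1 - th) * l) * (N%:R / l).
      by field; rewrite gt_eqF.
    by rewrite ler_pM2r // /u /p mul0r mulfV // gt_eqF.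
  rewrite /W /= !mulr0.
  have : L * (count stale (iota 0 N))%:R <= L * (kap * N%:R) by rewrite ler_wpM2l.
  move: ((count _ _)%:R) => c; nra.
have stot : 8 * (count stale (iota 0 N))%:R <= N%:R :> R by nra.
have [i [/andP[ni i3n] /negPn/asboolW[t [Kt pit tpi]] Wr Wl]] :=
  middle_good_index n W stale lam isT lam0 Wmono Wtot stot.
rewrite -/(p i) in pit; rewrite -/(p i.+1) in tpi.
have iN : (i < N)%N by apply: leq_trans i3n _; rewrite leq_mul2r orbT.
have quarter : 4^-1 <= t <= 3 / 4.
  apply/andP; split.
    apply: le_trans pit; rewrite ler_pdivlMr // /N natrM.
    have : n%:R <= i%:R :> R by rewrite ler_nat.
    by lra.
  apply: le_trans tpi _; rewrite ler_pdivrMr // /N natrM.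
  have : i.+1%:R <= 3 * n%:R :> R by rewrite -natrM ler_nat.
  lra.
have t01 : 0 <= t <= 1 by lra.
have pi01 := p01 i (ltnW iN).
have uit : `|u i - f (gam t)| <= (1 + eps) * (l / N%:R).
  apply: le_trans (lf _ _) _; apply: le_trans (nearK t (p i) Kt t01 pi01) _.
  rewrite -mulrA ler_wpM2l //; first lra.
  rewrite ler_pM2l // ler0_norm ?subr_le0 //; move: tpi; rewrite pS; lra.
have incr i1 i2 : (i1 <= i2)%N -> W i2 - W i1 <= lam * (i2%:R - i1%:R) ->
    (1 - lam) * (p i2 - p i1) * l <= u i2 - u i1.
  move=> i12 hW.
  have : (count stale (iota 0 i1))%:R <= (count stale (iota 0 i2))%:R :> R.
    by rewrite ler_nat -(subnKC i12) iotaD count_cat leq_addr.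
  move: hW; rewrite /W -(pN i1) -(pN i2) => hW cc.
  rewrite -(ler_pM2r Nl0).
  have -> : (1 - lam) * (p i2 - p i1) * l * (N%:R / l) = (1 - lam) * (p i2 - p i1) * N%:R.
    by field; rewrite gt_eqF.
  have : 0 <= (p i2 - p i1) * N%:R by rewrite mulrBl !pN subr_ge0 ler_nat.
  have : 0 <= L * ((count stale (iota 0 i2))%:R - (count stale (iota 0 i1))%:R).
    by rewrite mulr_ge0 // subr_ge0.
  nra.
have lN6 : 6 * (l / N%:R) <= xi by rewrite mulrA ler_pdivrMr.
have lN0 : 0 < l / N%:R by rewrite divr_gt0.
(* Passage from the grid point of the curve just before time [s] to the point of the line that
   corresponds to [s]. *)
have step s j r : 0 <= s <= 1 -> (j <= N)%N -> p j <= s -> s <= p j + N%:R^-1 ->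
    r = (s - t) * l ->
    `|u j - f (gam t + r *: e)| <= eps * (`|r| + l / N%:R) + l / N%:R.
  move=> s01 jN pjs spj rE; apply: le_trans (lf _ _) _.
  have -> : gam (p j) - (gam t + r *: e) =
     (gam (p j) - gam t - ((p j - t) * l) *: e) + ((p j - s) * l) *: e.
    by rewrite rE; apply/rowP => k; rewrite !mxE; ring.
  apply: le_trans (enormD _ _ _) _; apply: lerD.
    apply: le_trans (gamK t (p j) Kt t01 (p01 j jN)) _.
    rewrite -mulrA ler_wpM2l // rE normrM (gtr0_norm l0).
    have -> : p j - t = (s - t) + (p j - s) by ring.
    have := ler_normD (s - t) (p j - s).
    have : `|p j - s| <= N%:R^-1 by rewrite ler0_norm ?subr_le0 //; lra.
    move: (`|_ + _|) (`|s - t|) (`|p j - s|) => a b c; nra.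
  rewrite enormZ e1 mulr1 normrM (gtr0_norm l0) mulrC ler_pM2l //.
  by rewrite ler0_norm ?subr_le0 //; lra.
exists t; split => // r /andP[r0 r8].
pose q := r / l.
have qE : q * l = r by rewrite mulfVK // gt_eqF.
have q0 : 0 <= q by rewrite divr_ge0 // ltW.
have q8 : q <= 8^-1 by rewrite ler_pdivrMr // mulrC.
have floorP s : 0 <= s <= 1 -> exists j, [/\ (j <= N)%N, p j <= s & s < p j + N%:R^-1].
  move=> /andP[s0 s1]; exists (Num.truncn (s * N%:R)).
  have := truncn_itv (mulr_ge0 s0 (ltW NR)) => /andP[h1 h2]; split.
  - rewrite -(ler_nat R); apply: le_trans h1 _.
    by rewrite -[leRHS]mul1r ler_pM2r.
  - by rewrite ler_pdivrMr.
  - by rewrite -pS ltr_pdivlMr.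
have ijP i1 i2 : p i1 < p i2.+1 -> (i1 <= i2)%N.
  by rewrite ltr_pM2r ?invr_gt0 // ltr_nat ltnS.
have /andP[ui1 ui2] : - ((1 + eps) * (l / N%:R)) <= u i - f (gam t) <= (1 + eps) * (l / N%:R).
  by rewrite -ler_norml.
have el : eps * (l / N%:R) <= l / N%:R by rewrite -[leRHS]mul1r ler_pM2r.
have lamN : (1 - lam) * (l / N%:R) <= l / N%:R.
  by rewrite -[leRHS]mul1r ler_pM2r //; lra.
split.
  have s01 : 0 <= t + q <= 1 by lra.
  have [j [jN pj1 pj2]] := floorP _ s01.
  have ij : (i <= j)%N by apply: ijP; rewrite pS; lra.
  have := step _ j r s01 jN pj1 (ltW pj2).
  rewrite addrAC subrr add0r qE (ger0_norm r0) => /(_ erefl).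
  rewrite ler_norml => /andP[_].
  have hij : (i <= j <= N)%N by rewrite ij.
  have := incr i j ij (Wr j hij).
  have : (1 - lam) * (r - l / N%:R) <= (1 - lam) * (p j - p i) * l.
    rewrite -[leRHS]mulrA ler_wpM2l ?subr_ge0 // -qE [l / _]mulrC -mulrBl ler_pM2r //; lra.
  lra.
have s01 : 0 <= t - q <= 1 by lra.
have [j [jN pj1 pj2]] := floorP _ s01.
have := step _ j (- r) s01 jN pj1 (ltW pj2).
rewrite addrAC subrr add0r mulNr qE normrN (ger0_norm r0) => /(_ erefl).
rewrite scaleNr ler_norml => /andP[+ _].
have [ij|ji] := leqP j i.
  have := incr j i ij (Wl j ij).
  have : (1 - lam) * (r - l / N%:R) <= (1 - lam) * (p i - p j) * l.
    rewrite -[leRHS]mulrA ler_wpM2l ?subr_ge0 // -qE [l / _]mulrC -mulrBl ler_pM2r //.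
    by move: tpi; rewrite pS; lra.
  lra.
(* Here [t - q >= p j >= p i.+1 >= t], which forces [q = 0]; the claim is then trivial. *)
have : p i.+1 <= p j by rewrite ler_pM2r ?invr_gt0 // ler_nat.
move=> pij; have q00 : q = 0 by lra.
have r00 : r = 0 by rewrite -qE q00 mul0r.
by move=> _; rewrite r00 scale0r subr0 mulr0; lra.
Qed.

(** With [p = dotp e w] and [q] the last term, the square of the right side exceeds that of the left
    by exactly [(p + q) ^+ 2]. *)
Lemma enorm_shift_le (d : nat) (e w : pt d) (r : R) : enorm e = 1 -> 0 < r ->
  enorm (w + r *: e) <= r + dotp e w + enorm w ^+ 2 / (2 * r).
Proof.
move=> e1 r0; set h := enorm w.
have h0 : 0 <= h by exact: enorm_ge0.
have cs : - h <= dotp e w.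
  by have := normr_dotp _ e w; rewrite e1 mul1r ler_norml => /andP[].
have qE : h ^+ 2 / (2 * r) * (2 * r) = h ^+ 2 by rewrite mulfVK // mulf_neq0 ?pnatr_eq0 // gt_eqF.
have rhs0 : 0 <= r + dotp e w + h ^+ 2 / (2 * r).
  rewrite -(@pmulr_lge0 _ (2 * r)) ?mulr_gt0 // mulrDl qE.
  have := sqr_ge0 (r - h); have : 0 <= r * (dotp e w + h) by apply: mulr_ge0; [exact: ltW|lra].
  nra.
rewrite -(@ler_pXn2r _ 2) ?nnegrE ?enorm_ge0 // sqr_enorm.
rewrite dotpDl !dotpDr !dotpZl !dotpZr -!sqr_enorm e1 (dotpC _ w e) -/h.
move: qE; move: (h ^+ 2 / _) (dotp e w) => q p qE.
have := sqr_ge0 (p + q); rewrite -qE; nra.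
Qed.

(** The Lipschitz bounds between [y] and the two points [x - r *: e] and [x + r *: e] squeeze [f y].
    The choice [r = h / dl] balances the steepness defect [dl ^+ 2 * r = dl * h] against the
    curvature of the norm, [h ^+ 2 / (2 * r) = dl * h / 2]. *)
Lemma steep_linear (d : nat) (f : pt d -> R) (x e : pt d) (dl xi r0 : R) :
  lip_global d f -> enorm e = 1 -> 0 < dl -> 0 <= xi ->
  (forall r, 0 <= r <= r0 ->
    f x + (1 - dl ^+ 2) * r - xi <= f (x + r *: e) /\
    f (x - r *: e) <= f x - (1 - dl ^+ 2) * r + xi) ->
  forall y, enorm (y - x) <= dl * r0 ->
  `|f y - f x - dotp e (y - x)| <= xi + 2 * dl * enorm (y - x).
Proof.
move=> lf e1 dl0 xi0 st y; set h := enorm (y - x) => hr.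
have [h0|hn0] := eqVneq h 0.
  rewrite (enorm_eq0 _ _ h0) h0 mulr0 addr0 -{1}(subrK x y) (enorm_eq0 _ _ h0) add0r.
  by rewrite subrr -(scale0r e) dotpZr mul0r subrr normr0.
have h0 : 0 < h by rewrite lt0r hn0 enorm_ge0.
pose r := h / dl.
have rE : r * dl = h by rewrite mulfVK // gt_eqF.
have rp : 0 < r by rewrite divr_gt0.
have rr0 : 0 <= r <= r0 by rewrite ltW //= ler_pdivrMr // mulrC.
have [st1 st2] := st r rr0.
have n1 := enorm_shift_le _ e (y - x) r e1 rp.
have n2 := enorm_shift_le _ e (x - y) r e1 rp.
have up := lip_le _ _ y (x - r *: e) lf.
have lo := lip_le _ _ (x + r *: e) y lf.
have dN : dotp e (x - y) = - dotp e (y - x) by rewrite -dotpNr opprB.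
have xyh : enorm (x - y) = h by rewrite enorm_distC.
have hE : h ^+ 2 / (2 * r) = dl * h / 2 by rewrite -rE; field; rewrite gt_eqF.
rewrite dN xyh hE in n2; rewrite -/h hE in n1.
have E1 : y - (x - r *: e) = y - x + r *: e by rewrite opprB addrA addrAC.
have E2 : x + r *: e - y = x - y + r *: e by rewrite addrAC.
rewrite E1 in up; rewrite E2 in lo.
have dr : dl ^+ 2 * r = dl * h by rewrite -rE; ring.
rewrite ler_norml; apply/andP; split; nra.
Qed.

(** * Replacing a function by an affine one truncated to a band around it *)

Definition splice (d : nat) (f L : pt d -> R) (a : R) (y : pt d) :=
  Num.max (f y - a) (Num.min (L y) (f y + a)).

Lemma splice_lip (d : nat) (f L : pt d -> R) (a : R) :
  lip_global d f -> lip_global d L -> lip_global d (splice d f L a).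
Proof.
move=> lf lL x y.
have := lf x y; have := lL x y; rewrite !ler_norml => /andP[L1 L2] /andP[f1 f2].
rewrite /splice; case: (lerP (L x) (f x + a)) => ?; case: (lerP (L y) (f y + a)) => ?;
  case: (lerP (f x - a) _) => ?; case: (lerP (f y - a) _) => ?; apply/andP; split; lra.
Qed.

Lemma splice_close (d : nat) (f L : pt d -> R) (a : R) (y : pt d) :
  0 <= a -> `|f y - splice d f L a y| <= a.
Proof.
move=> a0; rewrite /splice ler_norml.
by case: (lerP (L y) (f y + a)) => ?; case: (lerP (f y - a) _) => ?; apply/andP; split; lra.
Qed.

Lemma splice_closer (d : nat) (f L : pt d -> R) (a : R) (y : pt d) :
  0 <= a -> `|splice d f L a y - L y| <= `|f y - L y|.
Proof.
move=> a0; have h1 := ler_norm (f y - L y); have := ler_norm (L y - f y).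
rewrite (distrC (L y)) (ler_norml (splice _ _ _ _ _ - _)) /splice.
move: h1; move: `|_| => n ? ?.
by case: (lerP (L y) (f y + a)) => ?; case: (lerP (f y - a) _) => ?; apply/andP; split; lra.
Qed.

Lemma splice_eq (d : nat) (f L : pt d -> R) (a : R) (y : pt d) :
  `|f y - L y| <= a -> splice d f L a y = L y.
Proof.
rewrite ler_norml => /andP[? ?]; rewrite /splice min_l; last lra.
by rewrite max_r //; lra.
Qed.

Definition affine (d : nat) (c : R) (x e : pt d) (y : pt d) := c + dotp e (y - x).

Lemma affine_lip (d : nat) (c : R) (x e : pt d) :
  enorm e = 1 -> lip_global d (affine d c x e).
Proof.
move=> e1 y z; rewrite /affine opprD addrACA subrr add0r -dotpNr -dotpDr.
rewrite opprB addrACA (addrC _ x) addrACA subrr add0r.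
by apply: le_trans (normr_dotp _ _ _) _; rewrite e1 mul1r.
Qed.

(** * Coverings by closed sets small in given directions *)

(* The existence of a derivative in [D] is part of the condition, so that no differentiability
   theorem for Lipschitz curves is needed. *)
Definition dir_null (d : nat) (D F : set (pt d)) : Prop :=
  forall gamma : R -> pt d,
    (exists L : R, forall s t : R, `[0, 1]%classic s -> `[0, 1]%classic t ->
       enorm (gamma s - gamma t) <= L * `|s - t|) ->
    (@lebesgue_measure R).-negligible
      (`[0, 1]%classic `&` [set t | F (gamma t) /\ exists v, D v /\ curve_deriv d gamma t v]).

(** Stated for codes rather than points, so that it can be localised to cylinders. *)
Definition coverable (d : nat) (g : (nat -> nat) -> pt d) (D : set (pt d))
    (S : set (nat -> nat)) : Prop :=
  exists C : nat -> set (pt d), (forall n, eclosed d (C n) /\ dir_null d D (C n)) /\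
    forall s, S s -> exists n, C n (g s).

Definition cyl (s : nat -> nat) (n : nat) : set (nat -> nat) :=
  [set t | forall k : nat, ltn k n -> t k = s k].

(** The analogue of the perfect kernel: what remains of [S] once every coverable cylinder piece is
    deleted. *)
Definition kernel (d : nat) (g : (nat -> nat) -> pt d) (D : set (pt d))
    (S : set (nat -> nat)) : set (nat -> nat) :=
  [set s | S s /\ forall n, ~ coverable d g D (S `&` cyl s n)].

Lemma dir_nullS (d : nat) (D D' F F' : set (pt d)) :
  D' `<=` D -> F' `<=` F -> dir_null d D F -> dir_null d D' F'.
Proof.
move=> DD FF nF gam lg; apply: negligibleS (nF gam lg) => t [t01 [Ft [v [Dv gv]]]].
by split=> //; split; [exact: FF|exists v; split => //; exact: DD].
Qed.

Lemma dir_nullU (d : nat) (D D' F : set (pt d)) :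
  dir_null d D F -> dir_null d D' F -> dir_null d (D `|` D') F.
Proof.
move=> n1 n2 gam lg; apply: negligibleS (negligibleU (n1 gam lg) (n2 gam lg)).
move=> t [t01 [Ft [v [[Dv|Dv] gv]]]]; [left|right];
  by split=> //; split=> //; exists v.
Qed.

Lemma coverableS (d : nat) (g : (nat -> nat) -> pt d) (D D' : set (pt d))
    (S S' : set (nat -> nat)) :
  D' `<=` D -> S' `<=` S -> coverable d g D S -> coverable d g D' S'.
Proof.
move=> DD SS [C [Cp Cc]]; exists C; split=> [n|s /SS/Cc //].
by have [? h] := Cp n; split => //; apply: dir_nullS h.
Qed.

Lemma coverable_bigcup (d : nat) (g : (nat -> nat) -> pt d) (D : set (pt d))
    (S : nat -> set (nat -> nat)) :
  (forall n, coverable d g D (S n)) -> coverable d g D (\bigcup_n S n).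
Proof.
move=> /choice[C Cp].
pose dec n := odflt (0%N, 0%N) (unpickle n : option (nat * nat)).
exists (fun n => C (dec n).1 (dec n).2); split=> [n|s [n _ Ss]].
  by have [+ _] := Cp (dec n).1; apply.
have [_ /(_ s Ss)[k Ck]] := Cp n.
by exists (pickle (n, k)); rewrite /dec pickleK.
Qed.

(** If closed sets [C k] cover [S] and are small for the directions in [P i], some part of [S] over
    a single [C k] is still not coverable for [D]. Inside [C k] the directions in [P i] are
    harmless, so this part is not coverable for the remaining directions, and the induction goes on
    with it. *)
Lemma not_coverable_split (d : nat) (g : (nat -> nat) -> pt d) (I : eqType)
    (P : I -> set (pt d)) (r : seq I) (D : set (pt d)) (S : set (nat -> nat)) :
  ~ coverable d g D S -> (forall v, D v -> exists2 i, i \in r & P i v) ->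
  exists i S', [/\ i \in r, S' `<=` S & ~ coverable d g (D `&` P i) S'].
Proof.
elim: r D S => [|i r IH] D S ncov DP.
  exfalso; apply: ncov; exists (fun=> setT); split=> [n|s _]; last by exists 0%N.
  split=> // gam _; apply: (negligibleS (A := set0)); last exact: negligible_set0.
  by move=> t [_ [_ [v [/DP[]]]]].
have [[C [Cp Cc]]|] := pselect (coverable d g (D `&` P i) S); last first.
  by move=> nc; exists i, S; split=> //; rewrite mem_head.
have [[k nck]|] := pselect (exists k, ~ coverable d g D (S `&` (g @^-1` C k))); last first.
  move=> all_cov; exfalso; apply: ncov.
  apply: (coverableS _ _ D _ (\bigcup_k (S `&` (g @^-1` C k)))) => //.
    by move=> s Ss; have [k Ck] := Cc s Ss; exists k.
  apply: coverable_bigcup => k; apply: contrapT => nc; apply: all_cov; by exists k.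
have nc' : ~ coverable d g (D `\` P i) (S `&` (g @^-1` C k)).
  move=> [G [Gp Gc]]; apply: nck; exists (fun n => C k `&` G n); split; last first.
    by move=> s Ss; have [n Gn] := Gc s Ss; exists n; split => //; case: Ss.
  move=> n; have [[Cc1 Cn] [Gc1 Gn]] := (Cp k, Gp n); split.
    by move=> x xcl; split; [apply: Cc1|apply: Gc1] => e /xcl[y [[? ?] ?]]; exists y.
  apply: (dir_nullS _ ((D `&` P i) `|` (D `\` P i)) _ (C k `&` G n)) => //.
    by move=> v Dv; have [|] := pselect (P i v); [left|right].
  by apply: dir_nullU; [apply: dir_nullS Cn|apply: dir_nullS Gn] => // x [].
have [v [Dv nPv]|j [S' [jr S'S nc]]] := IH _ _ nc'.
  have [j] := DP v Dv; rewrite in_cons => /orP[/eqP->//|jr Pj]; by exists j.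
exists j, S'; split; first by rewrite in_cons jr orbT.
  by move=> s /S'S[].
by move=> /(coverableS _ _ _ ((D `\` P i) `&` P j) _ S') nc1; apply: nc; apply: nc1 => // v [[]].
Qed.

(** There are only countably many cylinders, one for each finite sequence. *)
Lemma kernel_compl_coverable (d : nat) (g : (nat -> nat) -> pt d) (D : set (pt d))
    (S : set (nat -> nat)) : coverable d g D (S `\` kernel d g D S).
Proof.
(* The last clause does not depend on [s]: it empties [Q p] unless the cylinder piece of [p] is
   coverable. *)
pose Q (p : seq nat) := [set s | [/\ S s, mkseq s (size p) = p &
  coverable d g D (S `&` [set t | mkseq t (size p) = p])]].
apply: (coverableS _ _ D _ (\bigcup_n Q (odflt [::] (unpickle n)))) => //.
  move=> s [Ss nk]; have [n cn] : exists n, coverable d g D (S `&` cyl s n).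
    apply: contrapT => h; apply: nk; split=> // n c; apply: h; by exists n.
  exists (pickle (mkseq s n)) => //; rewrite pickleK /=; split=> //.
    by rewrite size_mkseq.
  apply: coverableS cn => // t [St]; rewrite /= size_mkseq => tE; split=> // k kn.
  by have := congr1 (nth 0%N ^~ k) tE; rewrite !nth_mkseq.
apply: coverable_bigcup => n; set p := odflt _ _.
have [c|nc] := pselect (coverable d g D (S `&` [set t | mkseq t (size p) = p])).
  by apply: coverableS c => // s [].
apply: (coverableS _ _ D _ set0) => //; first by move=> s [].
exists (fun=> set0); split=> // _; split.
  by move=> x /(_ 1 ltr01)[y []].
move=> gam _; apply: (negligibleS (A := set0)); last exact: negligible_set0.
by move=> t [_ [[]]].
Qed.

Lemma coverableU (d : nat) (g : (nat -> nat) -> pt d) (D : set (pt d))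
    (S S' : set (nat -> nat)) :
  coverable d g D S -> coverable d g D S' -> coverable d g D (S `|` S').
Proof.
move=> c1 c2; pose T n := if n is 0%N then S else S'.
apply: (coverableS _ _ D _ (\bigcup_n T n)) => //.
  by move=> s [?|?]; [exists 0%N|exists 1%N].
by apply: coverable_bigcup => -[].
Qed.

(** The deleted part of [S] is coverable, so covering a piece of the kernel would cover the whole
    piece of [S]. *)
Lemma kernel_cyl (d : nat) (g : (nat -> nat) -> pt d) (D : set (pt d))
    (S : set (nat -> nat)) (s : nat -> nat) (n : nat) :
  kernel d g D S s -> ~ coverable d g D (kernel d g D S `&` cyl s n).
Proof.
move=> [Ss nc] c; apply: (nc n).
apply: coverableS (coverableU _ _ _ _ _ c (kernel_compl_coverable d g D S)) => //.
move=> t [St st]; have [kt|nkt] := pselect (kernel d g D S t).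
  by left.
by right.
Qed.

Lemma kernel_not_coverable (d : nat) (g : (nat -> nat) -> pt d) (D : set (pt d))
    (S : set (nat -> nat)) : ~ coverable d g D S -> ~ coverable d g D (kernel d g D S).
Proof.
move=> nc c; apply: nc.
apply: coverableS (coverableU _ _ _ _ _ c (kernel_compl_coverable d g D S)) => //.
by move=> t St; have [kt|nkt] := pselect (kernel d g D S t); [left|right].
Qed.

Lemma not_coverable_nonempty (d : nat) (g : (nat -> nat) -> pt d) (D : set (pt d))
    (S : set (nat -> nat)) : ~ coverable d g D S -> (exists s, S s) /\ (exists v, D v).
Proof.
move=> nc; split; apply: contrapT => h; apply: nc.
  exists (fun=> set0); split=> [n|s Ss]; last by exfalso; apply: h; exists s.
  split; first by move=> x /(_ 1 ltr01)[y []].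
  move=> gam _; apply: (negligibleS (A := set0)); last exact: negligible_set0.
  by move=> t [_ [[]]].
exists (fun=> setT); split=> [n|s _]; last by exists 0%N.
split=> // gam _; apply: (negligibleS (A := set0)); last exact: negligible_set0.
by move=> t [_ [_ [v [Dv _]]]]; apply: h; exists v.
Qed.

Definition cone (d : nat) (e : pt d) (eps : R) : set (pt d) :=
  [set v | 0 < enorm v /\ enorm (v - enorm v *: e) <= eps * enorm v].

(** Rounding the coordinates of [v / enorm v] to mesh [1 / m] splits [D] into finitely many pieces.
    Directions in one piece differ by at most [d / m], so that of any of its vectors serves as
    axis. *)
Lemma narrow_cone (d : nat) (g : (nat -> nat) -> pt d) (D : set (pt d))
    (S : set (nat -> nat)) (eps : R) :
  0 < eps -> (forall v, D v -> 0 < enorm v) -> ~ coverable d g D S ->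
  exists D' S' e, [/\ D' `<=` D, S' `<=` S, enorm e = 1,
    D' `<=` cone d e eps & ~ coverable d g D' S'].
Proof.
move=> eps0 Dpos nc.
pose m := (Num.truncn (d%:R / eps)).+1.
have m0 : 0 < m%:R :> R by rewrite ltr0n.
have dm : d%:R * m%:R^-1 <= eps.
  have : d%:R / eps < m%:R by apply: truncnS_gt.
  by rewrite ltr_pdivrMr // ler_pdivrMr // mulrC => /ltW.
(* The shift by 1 makes the truncated number nonnegative; the values run from [0] to [2 * m]. *)
pose c (v : pt d) i := Num.truncn ((v ord0 i / enorm v + 1) * m%:R).
pose P (phi : {ffun 'I_d -> 'I_(2 * m).+1}) : set (pt d) :=
  [set v | forall i, c v i = phi i :> nat].
have coord1 (v : pt d) i : 0 < enorm v -> -1 <= v ord0 i / enorm v <= 1.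
  move=> v0; have := coord_le_enorm _ v i; rewrite ler_norml => /andP[h1 h2].
  by rewrite ler_pdivlMr // ler_pdivrMr // mulN1r mul1r h1.
have cP v i : 0 < enorm v ->
    (c v i)%:R <= (v ord0 i / enorm v + 1) * m%:R < (c v i).+1%:R.
  move=> v0; apply: truncn_itv; rewrite mulr_ge0 ?ler0n //.
  by have := coord1 v i v0; lra.
have [v Dv|phi [S' [_ S'S nc']]] :=
    not_coverable_split _ _ _ P (enum {: {ffun 'I_d -> 'I_(2 * m).+1}}) _ _ nc.
  exists [ffun i => inord (c v i)]; first by rewrite mem_enum.
  move=> i; rewrite ffunE inordK // ltnS -(ler_nat R).
  have /andP[+ _] := cP v i (Dpos v Dv); move/le_trans; apply.
  rewrite natrM ler_wpM2r ?ler0n //; have := coord1 v i (Dpos v Dv); lra.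
have [_ [w [Dw Pw]]] := not_coverable_nonempty _ _ _ _ nc'.
have w0 := Dpos w Dw.
exists (D `&` P phi), S', ((enorm w)^-1 *: w); split=> //.
  by rewrite enormZ ger0_norm ?invr_ge0 ?ltW // mulVf // gt_eqF.
move=> v [Dv Pv]; have v0 := Dpos v Dv; split=> //.
have -> : v - enorm v *: ((enorm w)^-1 *: w) =
    enorm v *: ((enorm v)^-1 *: v - (enorm w)^-1 *: w).
  by rewrite scalerBr [in RHS]scalerA mulfV ?scale1r // gt_eqF.
rewrite enormZ (gtr0_norm v0) mulrC ler_pM2r //.
apply: le_trans dm; apply: enorm_le_coords => i; rewrite !mxE.
rewrite ![(enorm _)^-1 * _]mulrC -[leRHS]mul1r ler_pdivlMr //.
have := cP v i v0; have := cP w i w0; rewrite Pv Pw -natr1 => h1 h2.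
by rewrite -{1}(ger0_norm (ltW m0)) -normrM ler_norml; lra.
Qed.

(** * Curve fragments through closed sets that are not small *)

(** Take a small ball around a Lebesgue density point of [G] and shrink it to the hull of the part
    of [G] in its closure: the endpoints then lie in [G], no measure of [G] is lost and the length
    does not grow. *)
Lemma closed_dense_interval (T : realType) (G : set T) (kap dl : T) :
  (forall t : T, (forall e : T, 0 < e -> exists2 s : T, G s & `|s - t| < e) -> G t) ->
  ~ (@lebesgue_measure T).-negligible G -> 0 < kap -> kap <= 1 / 2 -> 0 < dl ->
  measurable G /\ exists a b, [/\ G a, G b, a < b, b - a < dl &
    ((((1 - kap) * (b - a))%:E) <= (@lebesgue_measure T) (G `&` `[a, b]%classic))%E].
Proof.
move=> Gcl Gnn kap0 kap12 dl0.
have Gclosed : closed G.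
  move=> t tcl; apply: Gcl => e e0.
  have [s [Gs st]] := tcl _ (nbhsx_ballx t e e0).
  by exists s => //; rewrite distrC.
have mG : measurable G by exact: closed_measurable.
split=> //.
have [t [Gt dens]] : exists t, G t /\
    (lebesgue_measure (G `&` ball t r) / lebesgue_measure (ball t r))%E @[r --> 0^'+] -->
    (1 : T)%:E.
  apply: contrapT => h; apply: Gnn; apply: negligibleS (lebesgue_density mG) => t Gt /= ct.
  apply: h; exists t; split=> //; move: ct; rewrite indicE mem_set //.
have gt1 : ((1 - kap)%:E < 1%:E :> \bar T)%E by rewrite lte_fin; lra.
have near1 := dens _ (open_ereal_gt' gt1).
have dl2 : 0 < dl / 4 by lra.
have [r [[r0 rdl] rdens]] := filter_ex
  (filterI (filterI (nbhs_right_gt (0 : T)) (nbhs_right_lt dl2)) near1).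
have r00 : 0 <= r by exact: ltW.
move: rdens; rewrite /= lebesgue_measure_ball // => rdens.
have r2 : 0 < r *+ 2 by rewrite pmulrn_rgt0.
have rdens' : (((1 - kap) * (r *+ 2))%:E <= lebesgue_measure (G `&` ball t r))%E.
  by move: rdens; rewrite inver gt_eqF // lte_pdivlMr // -EFinM => /ltW.
pose H := G `&` `[t - r, t + r]%classic.
have mH : measurable H by apply: measurableI.
have Ht : H t by split=> //=; rewrite in_itv /=; apply/andP; split; lra.
have Hcl x : (forall e : T, 0 < e -> exists2 s, H s & `|s - x| < e) -> H x.
  move=> hx; split; first by apply: Gcl => e /hx[s [Gs _] ?]; exists s.
  rewrite /= in_itv /= !leNgt; apply/andP; split; apply/negP => lt;
    rewrite -subr_gt0 in lt; have [s [_]] := hx _ lt;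
    rewrite /= in_itv /= ltr_norml => /andP[? ?] /andP[? ?]; lra.
have Hlb : has_lbound H by exists (t - r) => s [_]; rewrite /= in_itv => /andP[].
have Hub : has_ubound H by exists (t + r) => s [_]; rewrite /= in_itv => /andP[].
have Hinf : has_inf H by split=> //; exists t.
have Hsup : has_sup H by split=> //; exists t.
pose a := inf H; pose b := sup H.
have ale s : H s -> a <= s by apply: ge_inf.
have leb s : H s -> s <= b by apply: ub_le_sup.
have Ha : H a.
  apply: Hcl => e e0; have [s Hs sa] := inf_adherent e0 Hinf; exists s => //.
  by rewrite ltr_norml; have := ale s Hs; rewrite -/a in sa *; lra.
have Hb : H b.
  apply: Hcl => e e0; have [s Hs sa] := sup_adherent e0 Hsup; exists s => //.
  by rewrite ltr_norml; have := leb s Hs; rewrite -/b in sa *; lra.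
have ba2r : b - a <= r *+ 2.
  have [_] := Ha; have [_] := Hb; rewrite /= !in_itv /= mulr2n => /andP[? ?] /andP[? ?]; lra.
have low : (((1 - kap) * (r *+ 2))%:E <= lebesgue_measure (G `&` `[a, b]%classic))%E.
  apply: le_trans rdens' _; apply: le_measure; rewrite ?inE.
  - by apply: measurableI => //; exact: measurable_ball.
  - by apply: measurableI.
  move=> s [Gs bs]; split=> //.
  have Hs : H s.
    by split=> //; move: bs; rewrite /ball /= in_itv /= ltr_norml => /andP[? ?];
      apply/andP; split; lra.
  by rewrite /= in_itv /= ale //= leb.
have ab : a < b.
  rewrite ltNge; apply/negP => ba.
  have : (lebesgue_measure (G `&` `[a, b]%classic) <= 0)%E.
    apply: (@le_trans _ _ (lebesgue_measure `[a, b]%classic)).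
      by apply: le_measure; rewrite ?inE //; exact: measurableI.
    by rewrite lebesgue_measure_itv /= lte_fin ltNge ba.
  move=> /(le_trans low); rewrite lee_fin leNgt => /negP; apply.
  by apply: mulr_gt0 => //; lra.
exists a, b; split=> //.
- by case: Ha.
- by case: Hb.
- by apply: le_lt_trans ba2r _; rewrite mulr2n; lra.
apply: le_trans low; rewrite lee_fin ler_wpM2l //; lra.
Qed.

Lemma avoided_cells_le (T : realType) (G : set T) (a b kap : T) (N : nat) (stale : pred nat) :
  measurable G -> (0 < N)%N -> a < b ->
  (((1 - kap) * (b - a))%:E <= (@lebesgue_measure T) (G `&` `[a, b]%classic))%E ->
  (forall i s, stale i -> G s -> a + i%:R / N%:R * (b - a) <= s ->
     s <= a + i.+1%:R / N%:R * (b - a) ->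
     False) ->
  (count stale (iota 0 N))%:R <= kap * N%:R.
Proof.
move=> mG N0 ab; set w := b - a => low staleP.
have w0 : 0 < w by rewrite subr_gt0.
have NR : 0 < N%:R :> T by rewrite ltr0n.
pose p (i : nat) : T := a + i%:R / N%:R * w.
have key i : (lebesgue_measure (G `&` `[a, p i]%classic) <=
    (w / N%:R * (i%:R - (count stale (iota 0 i))%:R))%:E)%E.
  elim: i => [|i IH].
    rewrite subrr mulr0 /p mul0r mul0r addr0.
    apply: (@le_trans _ _ (lebesgue_measure `[a, a]%classic)).
      by apply: le_measure; rewrite ?inE //; exact: measurableI.
    by rewrite lebesgue_measure_itv /= ltxx.
  have pS : p i.+1 = p i + w / N%:R.
    by rewrite /p -natr1; field; rewrite gt_eqF.
  have wN : 0 < w / N%:R by rewrite divr_gt0.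
  have pp : p i < p i.+1 by rewrite pS ltrDl.
  have cS : (count stale (iota 0 i.+1) = count stale (iota 0 i) + stale i)%N.
    by rewrite -[in LHS](addn1 i) iotaD count_cat add0n /= addn0.
  have split_le : (lebesgue_measure (G `&` `[a, p i.+1]%classic) <=
      lebesgue_measure (G `&` `[a, p i]%classic) +
      lebesgue_measure (G `&` `[p i, p i.+1]%classic))%E.
    apply: (@le_trans _ _ (lebesgue_measure
        ((G `&` `[a, p i]%classic) `|` (G `&` `[p i, p i.+1]%classic)))).
      apply: le_measure; rewrite ?inE; [exact: measurableI| |].
        by apply: measurableU; exact: measurableI.
      move=> s [Gs]; rewrite /= in_itv /= => /andP[as_ sp].
      by have [sp'|ps] := leP s (p i); [left|right]; split=> //=;
        rewrite in_itv /= ?as_ ?sp ?(ltW ps).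
    by apply: measureU2; exact: measurableI.
  apply: le_trans split_le _.
  have : (lebesgue_measure (G `&` `[p i, p i.+1]%classic) <= (w / N%:R * (1 - (stale i)%:R))%:E)%E.
    case: (boolP (stale i)) => [st|_].
      rewrite (_ : _ `&` _ = set0) ?measure0 ?subrr ?mulr0 //.
      rewrite -subset0 => s [Gs]; rewrite /= in_itv /= => /andP[ps sp].
      exact: (staleP i s).
    rewrite subr0 mulr1; apply: (@le_trans _ _ (lebesgue_measure `[p i, p i.+1]%classic)).
      by apply: le_measure; rewrite ?inE //; exact: measurableI.
    by rewrite lebesgue_measure_itv /= lte_fin pp -EFinB lee_fin pS addrAC subrr add0r.
  move=> /(leeD IH) h; apply: le_trans h _; rewrite -EFinD lee_fin cS natrD -natr1 -mulrDr.
  by apply: ler_wpM2l; [exact: ltW|lra].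
have pN : p N = b by rewrite /p mulfV ?mul1r ?gt_eqF // addrC subrK.
have := le_trans low; rewrite -pN => /(_ _ (key N)); rewrite lee_fin.
rewrite [w / _ * _]mulrAC -mulrA mulrC ler_pM2l // ler_pdivlMr //; lra.
Qed.

(** Scale and speed are taken from countable sets, so that the times can be sorted into countably
    many classes. The rational speed exceeds [enorm v] by less than [eps / 2 * enorm v]; derivative,
    cone and speed errors add up to [2 * eps * enorm v]. *)
Lemma curve_deriv_secant (d : nat) (gam : R -> pt d) (t : R) (v e : pt d) (eps : R) :
  0 < eps -> enorm e = 1 -> cone d e eps v -> curve_deriv d gam t v ->
  exists (k : nat) (q : rat), 0 < ratr q :> R /\ forall s, `|s - t| < k.+1%:R^-1 ->
    enorm (gam s - gam t - ((s - t) * ratr q) *: e) <= 2 * eps * ratr q * `|s - t|.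
Proof.
move=> eps0 e1 [v0 ve] gv.
have ev0 : 0 < eps / 2 * enorm v by rewrite mulr_gt0 // divr_gt0.
have [del del0 hdel] := gv _ ev0.
have vq : enorm v < enorm v + eps / 2 * enorm v by rewrite ltrDl.
have [q] := rat_in_itvoo vq; rewrite in_itv /= => /andP[q1 q2].
exists (Num.truncn del^-1), q; split; first exact: lt_trans q1.
move=> s st.
have sd : `|s - t| < del.
  apply: lt_le_trans st _; rewrite -[leRHS]invrK lef_pV2 ?posrE ?invr_gt0 ?ltr0n //.
  by apply: ltW; exact: truncnS_gt.
have [->|st0] := eqVneq s t.
  by rewrite !subrr mul0r scale0r subr0 enorm0 normr0 mulr0.
have h0 : 0 < `|s - t| by rewrite normr_gt0 subr_eq0.
have hd : 0 < `|s - t| < del by rewrite h0.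
have := hdel _ hd; rewrite (addrC t) subrK; set h := s - t => der.
have hn0 : h != 0 by rewrite subr_eq0.
have -> : gam s - gam t - (h * ratr q) *: e =
   h *: ((h^-1 *: (gam s - gam t) - v) + (v - enorm v *: e) + ((enorm v - ratr q) *: e)).
  by apply/rowP => i; rewrite !mxE; field.
rewrite enormZ mulrC ler_pM2r //.
apply: le_trans (enormD _ _ _) _; rewrite enormZ e1 mulr1.
have := enormD _ (h^-1 *: (gam s - gam t) - v) (v - enorm v *: e).
have -> : `|enorm v - ratr q| = ratr q - enorm v by rewrite distrC gtr0_norm ?subr_gt0.
nra.
Qed.

(** Countably many sets [G k q] contain the relevant times, so one of them is not negligible. It is
    closed, hence nearly fills some interval shorter than [k.+1%:R^-1], on which the secant estimate
    holds throughout; this interval is rescaled to the unit interval. *)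
Lemma thick_curve (d : nat) (F D : set (pt d)) (e : pt d) (eps kap1 : R) :
  eclosed d F -> ~ dir_null d D F -> D `<=` cone d e eps -> enorm e = 1 ->
  0 < eps -> 0 < kap1 ->
  exists (gam : R -> pt d) (K : set R) (l L kap : R),
  [/\ 0 < l, 0 <= L, L * kap <= kap1 & kap <= kap1] /\
  [/\ forall t s, K t -> 0 <= t <= 1 -> 0 <= s <= 1 ->
        enorm (gam s - gam t - ((s - t) * l) *: e) <= 2 * eps * l * `|s - t|,
      forall t s, 0 <= t <= 1 -> 0 <= s <= 1 -> enorm (gam s - gam t) <= L * l * `|s - t|,
      cell_dense K kap, forall t, K t -> F (gam t) & K 0 /\ K 1].
Proof.
move=> Fcl nnull Dcone e1 eps0 kap10.
have [gam [[L' lipg] nneg]] : exists gam : R -> pt d,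
    (exists L : R, forall s t : R, `[0, 1]%classic s -> `[0, 1]%classic t ->
       enorm (gam s - gam t) <= L * `|s - t|) /\
    ~ (@lebesgue_measure R).-negligible
      (`[0, 1]%classic `&` [set t | F (gam t) /\ exists v, D v /\ curve_deriv d gam t v]).
  apply: contrapT => h; apply: nnull => gam lg; apply: contrapT => nn.
  by apply: h; exists gam.
pose L0 := Num.max 0 L'.
have L00 : 0 <= L0 by rewrite le_max lexx.
have lip0 s t : 0 <= s <= 1 -> 0 <= t <= 1 -> enorm (gam s - gam t) <= L0 * `|s - t|.
  move=> s01 t01; apply: le_trans (lipg s t _ _) _; rewrite /= ?in_itv //.
  by rewrite ler_wpM2r // le_max lexx orbT.
(* The secant estimate replaces the velocity condition because it survives limits in [t]. *)
pose G (k : nat) (q : R) : set R := [set t : R | [/\ 0 <= t <= 1, F (gam t), 0 < q &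
  forall s : R, 0 <= s <= 1 ->
  `|s - t| < k.+1%:R^-1 -> enorm (gam s - gam t - ((s - t) * q) *: e) <= 2 * eps * q * `|s - t|]].
have [k [q Gnn]] : exists k q, ~ (@lebesgue_measure R).-negligible (G k q).
  apply: contrapT => h; apply: nneg.
  pose dec n := odflt (0%N, 0) (unpickle n : option (nat * rat)).
  have bc : (@lebesgue_measure R).-negligible (\bigcup_n G (dec n).1 (ratr (dec n).2)).
    apply: negligible_bigcup => n; apply: contrapT => nn; apply: h.
    by exists (dec n).1, (ratr (dec n).2).
  apply: negligibleS bc => t [t01 [Ft [v [Dv gv]]]].
  have [k [q [q0 sec]]] := curve_deriv_secant _ _ _ _ e eps eps0 e1 (Dcone v Dv) gv.
  exists (pickle (k, q)) => //; rewrite /dec pickleK /=; split=> //.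
  by move=> s _; exact: sec.
have q0 : 0 < q.
  apply: contrapT => nq; apply: Gnn; apply: (negligibleS (A := set0)); last exact: negligible_set0.
  by move=> t [].
have Gcl t : (forall e : R, 0 < e -> exists2 s, G k q s & `|s - t| < e) -> G k q t.
  move=> ht.
  have t01 : 0 <= t <= 1.
    apply/andP; split; rewrite leNgt; apply/negP => lt; rewrite -subr_gt0 in lt;
    have [s [/andP[s0 s1] _ _ _]] := ht _ lt; rewrite ltr_norml => /andP[? ?]; lra.
  split=> //.
    apply: Fcl => r r0; have r1 : 0 < r / (L0 + 1) by rewrite divr_gt0 //; lra.
    have [s [s01 Fs _ _] st] := ht _ r1; exists (gam s); split=> //.
    apply: le_lt_trans (lip0 t s t01 s01) _; rewrite distrC.
    move: st; rewrite ltr_pdivlMr; last lra.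
    have := normr_ge0 (s - t); nra.
  move=> s s01 st; apply/ler_addgt0Pr => r r0.
  pose c := L0 + q + 2 * eps * q + 1.
  have c0 : 0 < c.
    have : 0 < eps * q by exact: mulr_gt0.
    by rewrite /c; lra.
  have rc : 0 < Num.min (k.+1%:R^-1 - `|s - t|) (r / c).
    by rewrite lt_min subr_gt0 st divr_gt0.
  have [u [u01 _ _ hu]] := ht _ rc; rewrite lt_min => /andP[ut1 ut2].
  have su : `|s - u| < k.+1%:R^-1.
    by apply: le_lt_trans (ler_distD t s u) _; rewrite (distrC t u) addrC -ltrBrDr.
  have := hu s s01 su; have := lip0 u t u01 t01.
  have -> : gam s - gam t - ((s - t) * q) *: e =
    (gam s - gam u - ((s - u) * q) *: e) + (gam u - gam t) + ((t - u) * q) *: e.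
    by apply/rowP => i; rewrite !mxE; ring.
  have := enormD _ (gam s - gam u - ((s - u) * q) *: e + (gam u - gam t)) (((t - u) * q) *: e).
  have := enormD _ (gam s - gam u - ((s - u) * q) *: e) (gam u - gam t).
  rewrite enormZ e1 mulr1 normrM (gtr0_norm q0) (distrC t u).
  have := ler_distD t s u; rewrite (distrC t u).
  move: ut2; rewrite ltr_pdivlMr // /c.
  have := normr_ge0 (u - t); have : 0 < eps * q by rewrite mulr_gt0.
  move: (`|u - t|) (`|s - u|) (`|s - t|) => x y z eq0 x0 hx hy h1 h2 h3 h4.
  have : 2 * (eps * q) * y <= 2 * (eps * q) * (z + x).
    by rewrite ler_wpM2l // mulr_ge0 // ltW.
  nra.
pose L := L0 / q.
have L0' : 0 <= L by rewrite divr_ge0 // ltW.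
(* The density is chosen after the piece, hence after [L], so that [L * kap] is small too. *)
pose kap := Num.min (1 / 2) (kap1 / (1 + L)).
have kap0 : 0 < kap by rewrite lt_min divr_gt0 //= divr_gt0 //; lra.
have kap12 : kap <= 1 / 2 by rewrite ge_min lexx.
have kapL : kap * (1 + L) <= kap1.
  by rewrite -ler_pdivlMr ?ge_min ?lexx ?orbT //; lra.
have k0 : 0 < k.+1%:R^-1 :> R by rewrite invr_gt0 ltr0n.
have [mG [a [b [Ga Gb ab bak dens]]]] := closed_dense_interval _ _ _ _ Gcl Gnn kap0 kap12 k0.
pose w := b - a.
have w0 : 0 < w by rewrite subr_gt0.
have [a01 b01] : 0 <= a <= 1 /\ 0 <= b <= 1 by case: Ga; case: Gb.
pose p t := a + t * w.
have pp s t : p s - p t = (s - t) * w by rewrite /p; ring.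
have p01 t : 0 <= t <= 1 -> 0 <= p t <= 1.
  move=> /andP[t0 t1]; rewrite /p.
  have : 0 <= t * w by rewrite mulr_ge0 // ltW.
  have : t * w <= w by rewrite -[leRHS]mul1r ler_pM2r.
  rewrite /w; lra.
exists (gam \o p), [set t | G k q (p t)], (q * w), L, kap; split; first split=> //.
- by rewrite mulr_gt0.
- by nra.
- by nra.
split.
- move=> t s [pt01 _ _ hp] t01 s01 /=.
  have := hp (p s) (p01 s s01); rewrite pp normrM (gtr0_norm w0).
  have -> : (s - t) * (q * w) = (s - t) * w * q by ring.
  have -> : 2 * eps * (q * w) * `|s - t| = 2 * eps * q * (`|s - t| * w) by ring.
  apply; apply: le_lt_trans bak; rewrite -/w -[leRHS]mul1r ler_pM2r //.
  by rewrite ler_norml; lra.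
- move=> t s t01 s01 /=; apply: le_trans (lip0 _ _ (p01 s s01) (p01 t t01)) _.
  rewrite pp normrM (gtr0_norm w0) /L.
  have -> : L0 / q * (q * w) * `|s - t| = L0 * (`|s - t| * w) by field; rewrite gt_eqF.
  by [].
- move=> N N0; apply: (avoided_cells_le _ (G k q) a b kap N) => //.
  move=> i s /negP + Gs ps sp; apply; apply: asboolT; exists ((s - a) / w); split.
  + by rewrite /= /p mulfVK ?gt_eqF // addrC subrK.
  + by rewrite ler_pdivlMr // lerBrDl.
  + by rewrite ler_pdivrMr // lerBlDl.
- by move=> t [].
- by split; rewrite /= /p ?mul0r ?mul1r ?addr0 // /w addrC subrK.
Qed.

(** * The Banach-Mazur game in Lip1 *)

Lemma supdist_lt_trans (d : nat) (f g h : pt d -> R) (r s t : R) : r + s <= t ->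
  supdist_lt d f g r -> supdist_lt d g h s -> supdist_lt d f h t.
Proof.
move=> rst [r' rr fg] [s' ss gh]; exists (r' + s').
  by apply: lt_le_trans rst; exact: ltrD.
by move=> x cx; apply: le_trans (ler_distD (g x) _ _) _; apply: lerD; auto.
Qed.

Lemma supdist_lt_weak (d : nat) (f g : pt d -> R) (r s : R) :
  r <= s -> supdist_lt d f g r -> supdist_lt d f g s.
Proof. by move=> rs [r' rr fg]; exists r' => //; exact: lt_le_trans rs. Qed.

(* Two elements of [Lip1] whose values on a fine grid have equal roundings are uniformly close,
   and there are countably many rounding patterns. *)
Lemma lip1_separable (d : nat) : exists q : nat -> (pt d -> R),
  (forall n, Lip1 d (q n)) /\
  forall f, Lip1 d f -> forall eta : R, 0 < eta -> exists n, supdist_lt d f (q n) eta.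
Proof.
pose x_ M (phi : {ffun 'I_d -> 'I_M.+2}) : pt d := \row_i ((phi i)%:R / M.+1%:R).
pose cls M (f : pt d -> R) : seq int :=
  [seq Num.floor (f (x_ M phi) * M.+1%:R) | phi <- enum {: {ffun 'I_d -> 'I_M.+2}}].
pose dec n := odflt (0%N, [::]) (unpickle n : option (nat * seq int)).
(* One representative per rounding pattern; the zero function stands in for patterns that do not
   occur. *)
have /choice[q qP] : forall n, exists h, Lip1 d h /\
    forall f, Lip1 d f -> cls (dec n).1 f = (dec n).2 -> cls (dec n).1 h = (dec n).2.
  move=> n; have [[h [lh ch]]|no] := pselect (exists h, Lip1 d h /\ cls (dec n).1 h = (dec n).2).
    by exists h; split.
  exists (fun=> 0); split; first by move=> x y _ _; rewrite subrr normr0 enorm_ge0.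
  by move=> f lf cf; exfalso; apply: no; exists f.
exists q; split=> [n|f lf eta eta0]; first by case: (qP n).
(* Moving to a grid point costs [d%:R / M.+1%:R] for each of the two functions, rounding costs
   [1 / M.+1%:R]. *)
pose M := Num.truncn ((2 * d%:R + 1) / eta).
have M0 : 0 < M.+1%:R :> R by rewrite ltr0n.
pose n := pickle (M, cls M f).
exists n; exists ((2 * d%:R + 1) / M.+1%:R).
  by rewrite ltr_pdivrMr // [ltRHS]mulrC -ltr_pdivrMr //; exact: truncnS_gt.
have [lq] := qP n; rewrite /dec pickleK /= => /(_ f lf erefl) cq.
move=> x cx.
pose phi : {ffun 'I_d -> 'I_M.+2} := [ffun i => inord (Num.truncn (x ord0 i * M.+1%:R))].
have normM (z : R) : (`|z| <= M.+1%:R^-1) = (`|z * M.+1%:R| <= 1).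
  by rewrite normrM (gtr0_norm M0) -[X in _ <= X]mul1r ler_pdivlMr.
have xphi i : `|(x - x_ M phi) ord0 i| <= M.+1%:R^-1.
  have /andP[x0 x1] := cx i.
  have /andP[t1 t2] := truncn_itv (mulr_ge0 x0 (ltW M0)).
  have tM : (Num.truncn (x ord0 i * M.+1%:R) < M.+2)%N.
    rewrite ltnS -(ler_nat R); apply: le_trans t1 _.
    by rewrite -[leRHS]mul1r ler_pM2r.
  rewrite normM !mxE ffunE inordK // mulrBl mulfVK ?gt_eqF //.
  move: t2; rewrite -[ltRHS]natr1 => t2.
  by rewrite ler_norml; lra.
have cphi : cube d (x_ M phi).
  by move=> i; rewrite mxE divr_ge0 //= ler_pdivrMr // mul1r ler_nat -ltnS.
have fl : Num.floor (f (x_ M phi) * M.+1%:R) = Num.floor (q n (x_ M phi) * M.+1%:R).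
  by move/eq_in_map: cq => /(_ phi) ->//; rewrite mem_enum.
have close : `|f (x_ M phi) - q n (x_ M phi)| <= M.+1%:R^-1.
  rewrite normM mulrBl.
  have := real_floor_itv (num_real (f (x_ M phi) * M.+1%:R)); rewrite fl => /andP[a1 a2].
  have /andP[b1 b2] := real_floor_itv (num_real (q n (x_ M phi) * M.+1%:R)).
  by rewrite intrD in a2 b2; rewrite ler_norml; lra.
have xx : enorm (x - x_ M phi) <= d%:R * M.+1%:R^-1 by exact: enorm_le_coords.
have := lf x (x_ M phi) cx cphi; have := lq x (x_ M phi) cx cphi.
rewrite mulrDl mul1r -mulrA.
have := ler_distD (f (x_ M phi)) (f x) (q n x).
have := ler_distD (q n (x_ M phi)) (f (x_ M phi)) (q n x).
rewrite (distrC (q n (x_ M phi)) (q n x)).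
by move: close xx; move: (M.+1%:R^-1) => c; lra.
Qed.

(* A winning strategy for the second player of the Banach-Mazur game yields residuality; as [Lip1]
   is separable the first player may be restricted to countably many moves, so that no disjoint
   families are needed. *)
Lemma banach_mazur (d : nat) (Z : Type) (V : Z -> Prop) (Rl : Z -> Z -> Prop)
    (U : Z -> set (pt d -> R)) (z0 : Z) (P : set (pt d -> R)) :
  V z0 -> (forall f, Lip1 d f -> U z0 f) ->
  (forall z h, V z -> Lip1 d h -> U z h -> exists2 r : R, 0 < r &
     forall h', Lip1 d h' -> supdist_lt d h h' r -> U z h') ->
  (forall z f (eta : R), V z -> Lip1 d f -> U z f -> 0 < eta -> exists z' f',
     [/\ V z', Rl z z', Lip1 d f', U z' f' & supdist_lt d f f' eta]) ->
  (forall f (zs : nat -> Z), Lip1 d f -> zs 0%N = z0 ->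
     (forall n, [/\ V (zs n), U (zs n) f & Rl (zs n) (zs n.+1)]) -> P f) ->
  lip_residual d P.
Proof.
move=> Vz0 Uz0 Uopen strat conc.
have [q [qlip qdense]] := lip1_separable d.
pose dec n := odflt (0%N, 0%N) (unpickle n : option (nat * nat)).
have /choice[resp respP] : forall zn : Z * nat, exists z', V zn.1 -> V z' /\
    (U zn.1 (q (dec zn.2).1) -> Rl zn.1 z' /\ exists f',
      [/\ Lip1 d f', U z' f' & supdist_lt d (q (dec zn.2).1) f' (dec zn.2).2.+1%:R^-1]).
  move=> [z n] /=; have [[Vz Uz]|no] := pselect (V z /\ U z (q (dec n).1)).
    have pos : 0 < (dec n).2.+1%:R^-1 :> R by rewrite invr_gt0 ltr0n.
    have [z' [f' [? ? ? ? ?]]] := strat z _ _ Vz (qlip (dec n).1) Uz pos.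
    by exists z' => _; split=> // _; split=> //; exists f'.
  by exists z => Vz; split=> // Uz; exfalso; apply: no.
(* [st l] is the position after the first player's moves in [l], latest move first. A move codes a
   function [q i] and a radius. *)
pose st := foldr (fun n z => resp (z, n)) z0.
have Vst l : V (st l) by elim: l => //= n l IH; have [] := respP (st l, n) IH.
(* Functions still allowed after [l] but lost under every legal next move. Responses come
   arbitrarily close to any allowed function and leave open sets, so [N l] is nowhere dense; a
   function in no [N l] follows an infinite play. *)
pose N l := [set f | [/\ Lip1 d f, U (st l) f &
  forall n, U (st l) (q (dec n).1) -> ~ U (st (n :: l)) f]].
exists (fun k => N (odflt [::] (unpickle k))); split.
  move=> k; set l := odflt _ _; move=> [f [r [r0 lf] ball]].
  have r4 : 0 < r / 4 by lra.
  have [_ /(_ _ r4)[h [lh [_ Uh _] fh]]] : lip_closure d (N l) f.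
    by apply: ball => //; exists 0 => // x _; rewrite subrr normr0.
  have [rho rho0 rhoU] := Uopen _ _ (Vst l) lh Uh.
  have m0 : 0 < Num.min rho (r / 4) by rewrite lt_min rho0.
  have [k1 hk1] := qdense h lh _ m0.
  have Uq : U (st l) (q k1).
    by apply: rhoU => //; apply: supdist_lt_weak hk1; rewrite ge_min lexx.
  pose j := Num.truncn (4 / r); pose n := pickle (k1, j).
  have [_] := respP (st l, n) (Vst l).
  rewrite {1}/n /dec pickleK /= => /(_ Uq)[_ [f' [lf' Uf' qf']]].
  have jr : j.+1%:R^-1 <= r / 4.
    rewrite -[r / 4]invrK lef_pV2 ?posrE ?invr_gt0 ?ltr0n // invf_div.
    by apply: ltW; exact: truncnS_gt.
  have ff' : supdist_lt d f f' r.
    pose r1 := r / 4; pose r2 := r / 2.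
    have hq : supdist_lt d h (q k1) r1.
      by apply: supdist_lt_weak hk1; rewrite ge_min lexx orbT.
    have qf : supdist_lt d (q k1) f' r1 by apply: supdist_lt_weak qf'.
    have hf : supdist_lt d h f' r2.
      by apply: supdist_lt_trans hq qf; rewrite /r1 /r2; lra.
    by apply: supdist_lt_trans fh hf; rewrite /r2; lra.
  have [rho' rho'0 rhoU'] := Uopen _ _ (Vst (n :: l)) lf' Uf'.
  have [_ /(_ _ rho'0)[h2 [lh2 [_ _ nU] f'h2]]] := ball f' lf' ff'.
  apply: (nU n); last exact: rhoU'.
  by rewrite /dec /n pickleK.
move=> f lf nPf; apply: contrapT => noN; apply: nPf.
have /choice[nx nxP] : forall l, exists n, U (st l) f ->
    U (st l) (q (dec n).1) /\ U (st (n :: l)) f.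
  move=> l; have [Ul|] := pselect (U (st l) f); last by exists 0%N.
  apply: contrapT => no; apply: noN; exists (pickle l); rewrite pickleK /=; split=> //.
  by move=> n Uq Un; apply: no; exists n.
pose ls := fix ls n := if n is m.+1 then nx (ls m) :: ls m else [::].
have Uls n : U (st (ls n)) f.
  by elim: n => [|n IH] /=; [exact: Uz0|have [] := nxP _ IH].
apply: (conc f (fun n => st (ls n))) => // n; split=> //.
have [Uq _] := nxP _ (Uls n).
have [_ /(_ Uq)[]] := respP (st (ls n), nx (ls n)) (Vst _).
by [].
Qed.

(** * The strategy *)

Definition ecl (d : nat) (g : (nat -> nat) -> pt d) (S : set (nat -> nat)) : set (pt d) :=
  [set x | forall r : R, 0 < r -> exists s, S s /\ enorm (x - g s) < r].

Lemma ecl_closed (d : nat) (g : (nat -> nat) -> pt d) (S : set (nat -> nat)) :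
  eclosed d (ecl d g S).
Proof.
move=> x xcl r r0; have r2 : 0 < r / 2 by lra.
have [y [yS xy]] := xcl _ r2; have [s [Ss ys]] := yS _ r2.
by exists s; split=> //; have := enorm_triangle _ y x (g s); lra.
Qed.

Lemma ecl_not_dir_null (d : nat) (g : (nat -> nat) -> pt d) (D : set (pt d))
    (S : set (nat -> nat)) : ~ coverable d g D S -> ~ dir_null d D (ecl d g S).
Proof.
move=> nc nl; apply: nc; exists (fun=> ecl d g S); split=> [_|s Ss].
  by split=> //; exact: ecl_closed.
by exists 0%N => r r0; exists s; rewrite subrr enorm0.
Qed.

Lemma ecl_cube (d : nat) (g : (nat -> nat) -> pt d) (S : set (nat -> nat)) :
  (forall s, cube d (g s)) -> ecl d g S `<=` cube d.
Proof.
move=> gc x xS i; apply/andP; split; rewrite leNgt; apply/negP => lt;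
  rewrite -subr_gt0 in lt; have [s [_ xs]] := xS _ lt;
  have := le_lt_trans (coord_le_enorm _ _ i) xs; rewrite !mxE ltr_norml => /andP[? ?];
  have /andP[? ?] := gc s i; lra.
Qed.

Lemma ecl_near (d : nat) (g : (nat -> nat) -> pt d) (S : set (nat -> nat)) (x : pt d) (r : R) :
  0 < r -> (forall s, S s -> enorm (g s - x) <= r) ->
  forall y, ecl d g S y -> enorm (y - x) <= 2 * r.
Proof.
move=> r0 near y yS; have [s [Ss ys]] := yS _ r0.
by have := enorm_triangle _ (g s) y x; have := near s Ss; lra.
Qed.

Definition dlt (n : nat) : R := n.+1%:R^-1.
(** Squared because a steepness defect [dl ^+ 2] gives linear approximation only to order [dl]. The
    index is shifted because the cone of level [n] enters the estimate at level [n.+1]: there 16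
    times eight errors of at most [aper n] give [dlt n.+1 ^+ 2 / 2]. *)
Definition aper (n : nat) := dlt n.+1 ^+ 2 / 16 / 16.

Lemma dlt_gt0 (n : nat) : 0 < dlt n.
Proof. by rewrite invr_gt0 ltr0n. Qed.

Lemma dlt_le1 (n : nat) : dlt n <= 1.
Proof. by rewrite invf_le1 ?ltr0n // ler1n. Qed.

Lemma dlt_le (m n : nat) : (m <= n)%N -> dlt n <= dlt m.
Proof. by move=> mn; rewrite lef_pV2 ?posrE ?ltr0n // ler_nat. Qed.

Lemma aper_gt0 (n : nat) : 0 < aper n.
Proof. by do 2 apply: divr_gt0 => //; apply: exprn_gt0; exact: dlt_gt0. Qed.

Lemma aper_le (m n : nat) : (m <= n)%N -> aper n <= aper m.
Proof.
move=> mn; rewrite !ler_pM2r //; apply: lerXn2r; rewrite ?nnegrE.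
- by apply: ltW; exact: dlt_gt0.
- by apply: ltW; exact: dlt_gt0.
- exact: dlt_le.
Qed.

Lemma aper_le_dlt (n : nat) : aper n <= dlt n.
Proof.
have := dlt_gt0 n.+1; have := dlt_le1 n.+1; have := dlt_le n n.+1 (leqnSn n).
by rewrite /aper; nra.
Qed.

Lemma cone_axes_close (d : nat) (e e' : pt d) (eps eps' : R) (v : pt d) :
  cone d e eps v -> cone d e' eps' v -> enorm (e - e') <= eps + eps'.
Proof.
move=> [v0 h1] [_ h2]; rewrite -(ler_pM2l v0) -{1}(gtr0_norm v0) -enormZ scalerBr.
have := enorm_triangle _ v (enorm v *: e) (enorm v *: e').
by rewrite (enorm_distC _ _ v); lra.
Qed.

(* A position of the game: the remaining open set [st_U] of functions, the remaining codes
   [st_S] of points of the analytic set, the remaining velocities [st_D] with axis [st_e], and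
   the scale [st_al] down to which linear approximation is already guaranteed. *)
Record state (d : nat) := State {
  st_lvl : nat; st_U : set (pt d -> R); st_S : set (nat -> nat);
  st_D : set (pt d); st_e : pt d; st_al : R }.

(** The centre [x] may depend on [f] and [rho]. The factor 2 leaves room to move the centre
    later. *)
Definition ready (d : nat) (g : (nat -> nat) -> pt d) (n : nat) (U : set (pt d -> R))
    (S : set (nat -> nat)) (e : pt d) (al : R) : Prop :=
  forall f, Lip1 d f -> U f -> forall rho : R, 0 < rho -> exists2 x, ecl d g S x &
    forall y, rho <= enorm (y - x) <= 2 * al ->
    `|(f \o clamp d) y - (f \o clamp d) x - dotp e (y - x)| <= 3 * dlt n * enorm (y - x).

Definition valid (d : nat) (g : (nat -> nat) -> pt d) (z : state d) : Prop :=
  [/\ 0 < st_al d z /\ enorm (st_e d z) = 1,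
      st_D d z `<=` cone d (st_e d z) (aper (st_lvl d z)),
      (exists s, st_S d z s) /\
      forall s n, st_S d z s -> ~ coverable d g (st_D d z) (st_S d z `&` cyl s n),
      ready d g (st_lvl d z) (st_U d z) (st_S d z) (st_e d z) (st_al d z) &
      forall h, Lip1 d h -> st_U d z h -> exists2 r : R, 0 < r &
        forall h', Lip1 d h' -> supdist_lt d h h' r -> st_U d z h'].

(** The last clause holds for every centre in the new closure, hence for the limit point; the ranges
    of scales of successive moves adjoin, so they cover all small distances. *)
Definition follows (d : nat) (g : (nat -> nat) -> pt d) (z z' : state d) : Prop :=
  [/\ st_lvl d z' = (st_lvl d z).+1,
      st_S d z' `<=` st_S d z /\
      forall s t k, st_S d z' s -> st_S d z' t -> (k <= st_lvl d z)%N -> s k = t k,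
      st_D d z' `<=` st_D d z, st_al d z' <= st_al d z / 2 &
      forall h x y, Lip1 d h -> st_U d z' h -> ecl d g (st_S d z') x -> cube d y ->
        st_al d z' <= enorm (y - x) <= st_al d z ->
        `|h y - h x - dotp (st_e d z) (y - x)| <= 9 * dlt (st_lvl d z) * enorm (y - x)].

Lemma ready_near_affine (d : nat) (g : (nat -> nat) -> pt d) (S : set (nat -> nat))
    (D : set (pt d)) (n : nat) (f' : pt d -> R) (c : R) (x e e' : pt d) (rho : R) :
  (forall s, cube d (g s)) -> ~ coverable d g D S ->
  D `<=` cone d e (aper n) -> D `<=` cone d e' (aper n.+1) ->
  enorm e = 1 -> enorm e' = 1 ->
  (forall y, enorm (y - x) <= rho -> f' y = affine d c x e y) ->
  ecl d g S `<=` [set y | enorm (y - x) <= rho] ->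
  exists al1 r1 : R, [/\ 0 < al1, 0 < r1 & forall al r : R, 0 < al <= al1 -> r <= r1 ->
    ready d g n.+1 [set h | supdist_lt d f' h r] S e' al].
Proof.
move=> gc nc De De' e1 e'1 f'L near.
have [_ [v Dv]] := not_coverable_nonempty _ _ _ _ nc.
have ee' := cone_axes_close _ _ _ _ _ _ (De v Dv) (De' v Dv).
have a0 := aper_gt0 n; have a'0 := aper_gt0 n.+1.
have a'a := aper_le n n.+1 (leqnSn n).
have [gam [K [l [L [kap [[l0 L0 Lk kk] [gK gL Kd KF [K0 K1]]]]]]]] :=
  thick_curve _ _ _ _ _ _ (ecl_closed d g S) (ecl_not_dir_null _ _ _ _ nc) De' e'1 a'0 a'0.
pose dl := dlt n.+1.
have dl0 : 0 < dl by exact: dlt_gt0.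
have dl1 : dl <= 1 by exact: dlt_le1.
have adl : aper n = dl ^+ 2 / 16 / 16 by [].
have dl2 : dl ^+ 2 <= 1 by rewrite expr_le1 // ltW.
(* [2 * al] must not exceed the range [dl * (l / 8)] of [steep_linear]; passing from [f'] to [h] at
   both ends of the curve costs at most [aper n.+1 * l]. *)
exists (dl * l / 16), (aper n.+1 * l / 2); split.
- by rewrite divr_gt0 // mulr_gt0.
- by rewrite divr_gt0 // mulr_gt0.
move=> al r /andP[al0 al1] r1 h lh Uh rho1 rho10.
have lhc := lip_global_clamp d h lh.
have F01 : ecl d g S (gam 0) /\ ecl d g S (gam 1) by split; exact: KF.
have c01 : cube d (gam 0) /\ cube d (gam 1).
  by split; apply: (ecl_cube d g S) => //; case: F01.
have [r' r'r hf'] := Uh.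
have dot_ee' : 1 - (aper n + aper n.+1) <= dotp e e'.
  have := normr_dotp _ e (e' - e); rewrite e1 mul1r dotpDr dotpNr -sqr_enorm e1 expr1n.
  rewrite enorm_distC in ee'.
  by move=> /le_trans/(_ ee'); rewrite ler_norml => /andP[? ?]; lra.
(* Losses: [aper n + aper n.+1] for the angle of the axes, [2 * aper n.+1] for the bending of the
   curve, [aper n.+1] for the distance of [h] from [f']. *)
have steep : (1 - (aper n + 4 * aper n.+1)) * l <=
    (h \o clamp d) (gam 1) - (h \o clamp d) (gam 0).
  rewrite /= (clamp_id _ _ (proj1 c01)) (clamp_id _ _ (proj2 c01)).
  have := hf' _ (proj1 c01); have := hf' _ (proj2 c01).
  rewrite !f'L; [|exact: near (proj1 F01)|exact: near (proj2 F01)].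
  rewrite /affine => h1 h0.
  have i0 (t : R) : t = 0 -> 0 <= t <= 1 by move=> ->; rewrite lexx ler01.
  have i1 (t : R) : t = 1 -> 0 <= t <= 1 by move=> ->; rewrite lexx ler01.
  have := gK _ _ K0 (i0 _ erefl) (i1 _ erefl); rewrite subr0 mul1r normr1 mulr1 => gap.
  have : `|dotp e (gam 1 - gam 0 - l *: e')| <= 2 * aper n.+1 * l.
    by apply: le_trans (normr_dotp _ _ _) _; rewrite e1 mul1r.
  have -> : dotp e (gam 1 - gam 0 - l *: e') =
      dotp e (gam 1 - x) - dotp e (gam 0 - x) - l * dotp e e'.
    by rewrite -dotpZr -!dotpNr -!dotpDr opprB; congr (dotp _ (_ - _)); rewrite addrA subrK.
  have : l * (1 - (aper n + aper n.+1)) <= l * dotp e e' by rewrite ler_pM2l.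
  move: h1 h0; rewrite !ler_norml => /andP[? ?] /andP[? ?] ? /andP[? ?].
  nra.
have lam0 : 0 < dl ^+ 2 / 2 by rewrite divr_gt0 // exprn_gt0.
(* The error [xi = dl * rho1] is at most [dl * enorm (y - gam t)] at the distances considered,
   whence the constant 3 in [ready]. *)
have xi0 : 0 < dl * rho1 by rewrite mulr_gt0.
have eps01 : 0 <= 2 * aper n.+1 <= 1 by apply/andP; split; lra.
have lam1 : dl ^+ 2 / 2 <= 1 by lra.
have tot : 16 * (2 * aper n.+1 + (aper n + 4 * aper n.+1) + L * kap) <= dl ^+ 2 / 2 by lra.
have kap8 : 8 * kap <= 1 by lra.
have [t [Kt t01 ht]] := lip_steep_point _ _ _ _ _ _ _ _ _ _ _ _ lhc e'1 l0 L0 eps01 lam1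
  gK gL Kd steep lam0 tot kap8 xi0.
exists (gam t); first exact: KF.
move=> y /andP[y1 y2].
have st r0 : 0 <= r0 <= l / 8 ->
    (h \o clamp d) (gam t) + (1 - dl ^+ 2) * r0 - dl * rho1 <= (h \o clamp d) (gam t + r0 *: e') /\
    (h \o clamp d) (gam t - r0 *: e') <= (h \o clamp d) (gam t) - (1 - dl ^+ 2) * r0 + dl * rho1.
  move=> r08; have [s1 s2] := ht r0 r08.
  have : (1 - dl ^+ 2) * r0 <= (1 - dl ^+ 2 / 2 - 2 * aper n.+1) * r0.
    by apply: ler_wpM2r; [case/andP: r08|lra].
  by split; lra.
have yl : enorm (y - gam t) <= dl * (l / 8) by lra.
have := steep_linear _ _ _ _ _ _ _ lhc e'1 dl0 (ltW xi0) st y yl.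
move=> hy; apply: le_trans hy _; rewrite -/dl.
have : dl * rho1 <= dl * enorm (y - gam t) by rewrite ler_pM2l.
lra.
Qed.

Lemma game_step (d : nat) (g : (nat -> nat) -> pt d) (z : state d) (f : pt d -> R) (eta : R) :
  (forall s, cube d (g s)) -> baire_continuous d g ->
  valid d g z -> Lip1 d f -> st_U d z f -> 0 < eta ->
  exists z' f', [/\ valid d g z', follows d g z z', Lip1 d f', st_U d z' f' &
    supdist_lt d f f' eta].
Proof.
case: z => n U S D e al gc gcont [/= [al0 e1] Dcone [_ Sker] rdy _] lf Uf eta0.
(* Within [rho] of [x] the function and its affine model differ by at most [2 * rho <= eta / 2], so
   splicing makes them equal there. *)
pose rho := Num.min (eta / 4) al.
have rho0 : 0 < rho by rewrite lt_min al0 divr_gt0.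
have rhoal : rho <= al by rewrite ge_min lexx orbT.
have rhoeta : rho <= eta / 4 by rewrite ge_min lexx.
have [x xS fx] := rdy f lf Uf rho rho0.
pose ft := f \o clamp d.
have lft : lip_global d ft by exact: lip_global_clamp.
pose Lx := affine d (ft x) x e.
have lL : lip_global d Lx by exact: affine_lip.
pose a := eta / 2.
have a0 : 0 <= a by rewrite divr_ge0 // ltW.
pose f' := splice d ft Lx a.
have lf' : lip_global d f' by exact: splice_lip.
have lf'1 : Lip1 d f' by move=> y1 y2 _ _; exact: lf'.
have f'L y : enorm (y - x) <= rho -> f' y = Lx y.
  move=> yx; apply: splice_eq; rewrite /Lx /affine opprD addrA.
  apply: le_trans (ler_normB _ _) _.
  have := lft y x; have := normr_dotp _ e (y - x); rewrite e1 mul1r /a; lra.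
have f'near y : enorm (y - x) <= 2 * al -> `|f' y - Lx y| <= 3 * dlt n * enorm (y - x).
  move=> yx; have [yrho|rhoy] := leP (enorm (y - x)) rho.
    rewrite f'L // subrr normr0 mulr_ge0 ?enorm_ge0 // mulr_ge0 // ltW //; exact: dlt_gt0.
  apply: le_trans (splice_closer d ft Lx a y a0) _.
  by rewrite /Lx /affine opprD addrA; apply: fx; rewrite ltW.
(* The new piece then lies within [rho / 4] of [x] and its closure within [rho / 2]. *)
have r8 : 0 < rho / 8 by rewrite divr_gt0.
have [s [Ss xs]] := xS _ r8.
have [m0 hm0] := gcont s _ r8.
pose m := maxn m0 n.+1.
have nc1 := Sker s m Ss.
have near1 t : (S `&` cyl s m) t -> enorm (g t - x) <= rho / 4.
  move=> [_ st]; have : enorm (g t - g s) < rho / 8.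
    by apply: hm0 => k km; apply: st; apply: leq_trans km _; exact: leq_maxl.
  by have := enorm_triangle _ (g s) (g t) x; rewrite (enorm_distC _ (g s) x); lra.
have Dpos v : D v -> 0 < enorm v by move=> /Dcone[].
have [D' [S2 [e' [D'D S2S e'1 D'cone nc2]]]] :=
  narrow_cone _ _ _ _ _ (aper_gt0 n.+1) Dpos nc1.
pose S' := kernel d g D' S2.
have nc' : ~ coverable d g D' S' by exact: kernel_not_coverable.
have S'1 t : S' t -> (S `&` cyl s m) t by move=> [/S2S].
have r4 : 0 < rho / 4 by rewrite divr_gt0.
have eclnear y : ecl d g S' y -> enorm (y - x) <= rho / 2.
  have near' t : S' t -> enorm (g t - x) <= rho / 4 by move=> /S'1/near1.
  by move=> /(ecl_near _ _ _ _ _ r4 near'); lra.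
have eclsub : ecl d g S' `<=` [set y | enorm (y - x) <= rho].
  by move=> y /eclnear /=; lra.
have D'cone0 : D' `<=` cone d e (aper n) by move=> v /D'D/Dcone.
have [al1 [r1 [al10 r10 rdy']]] := ready_near_affine _ _ _ _ _ _ _ _ _ _ _
  gc nc' D'cone0 D'cone e1 e'1 f'L eclsub.
pose al' := Num.min (al / 2) al1.
have al'0 : 0 < al' by rewrite lt_min al10 divr_gt0.
have al'1 : al' <= al1 by rewrite ge_min lexx orbT.
have al'2 : al' <= al / 2 by rewrite ge_min lexx.
have dl0 := dlt_gt0 n.
(* The second bound makes the change from [f'] to [h] cost at most [dlt n] times the distance, at
   distances at least [al']. *)
pose r := Num.min r1 (dlt n * al').
have r0 : 0 < r by rewrite lt_min r10 mulr_gt0.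
have rr1 : r <= r1 by rewrite ge_min lexx.
have rr2 : r <= dlt n * al' by rewrite ge_min lexx orbT.
pose z' := State d n.+1 [set h | supdist_lt d f' h r] S' D' e' al'.
exists z', f'; split=> //.
- split=> //=.
  + split; first by have [] := not_coverable_nonempty _ _ _ _ nc'.
    by move=> t k; exact: kernel_cyl.
  + by apply: rdy' => //; rewrite al'0.
  + move=> h lh [r2 r2r hr2]; pose r3 := r - r2.
    exists r3; first by rewrite subr_gt0.
    move=> h' lh' [r4' r43 hh']; exists (r2 + r4'); first by move: r43; rewrite /r3; lra.
    move=> y cy; apply: le_trans (ler_distD (h y) _ _) _.
    by apply: lerD; [exact: hr2|exact: hh'].
- split=> //=.
  + split=> [t /S'1[]//|t u k /S'1[_ ts] /S'1[_ us] kn].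
    have km : (k < m)%N by apply: leq_trans (leq_maxr _ _); rewrite ltnS.
    by rewrite ts // us.
  + move=> h y1 y lh [r2 r2r hr2] y1S cy /andP[yal' yal].
    have cy1 : cube d y1 by exact: (ecl_cube d g S').
    have y1x := eclnear y1 y1S.
    have f'y1 : f' y1 = Lx y1 by apply: f'L; lra.
    have tri := enorm_triangle _ y1 y x.
    have yx : enorm (y - x) <= 2 * al by lra.
    (* Either [f'] is exactly affine at [y], or [y] is farther than [rho] from [x]; since [y1] is
       within [rho / 2] of [x], the change of centre then at most doubles the constant 3. *)
    have main : `|f' y - Lx y| <= 6 * dlt n * enorm (y - y1).
      have [yrho|rhoy] := leP (enorm (y - x)) rho.
        rewrite f'L // subrr normr0 mulr_ge0 ?enorm_ge0 // mulr_ge0 // ltW //.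
      apply: le_trans (f'near y yx) _.
      have : dlt n * enorm (y - x) <= dlt n * (2 * enorm (y - y1)).
        by rewrite ler_pM2l //; lra.
      lra.
    have LL : Lx y - Lx y1 = dotp e (y - y1).
      by rewrite /Lx /affine opprD addrACA subrr add0r -dotpNr -dotpDr opprB addrA subrK.
    have h1 := hr2 y cy; have h2 := hr2 y1 cy1.
    have : dlt n * al' <= dlt n * enorm (y - y1) by rewrite ler_pM2l.
    move: main h1 h2; rewrite -LL f'y1 !ler_norml => /andP[? ?] /andP[? ?] /andP[? ?] ?.
    by apply/andP; split; lra.
- by exists 0 => // y _; rewrite subrr normr0.
- exists a; first by rewrite /a; lra.
  move=> y cy; have := splice_close d ft Lx a y a0.
  by rewrite /ft /= (clamp_id _ _ cy).
Qed.

(** * The limit of a play *)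

Lemma open_cube_ball (d : nat) (x : pt d) : open_cube d x ->
  exists2 w : R, 0 < w & forall y, enorm (y - x) < w -> cube d y.
Proof.
move=> xo.
pose w := \big[Num.min/1]_(i < d) Num.min (x ord0 i) (1 - x ord0 i).
exists w.
  apply: lt_bigmin => // i _; rewrite lt_min.
  by have /andP[? ?] := xo i; rewrite subr_gt0; apply/andP.
move=> y yx i; have := le_lt_trans (coord_le_enorm _ _ i) yx.
rewrite !mxE => h.
have : w <= Num.min (x ord0 i) (1 - x ord0 i) by exact: bigmin_le.
rewrite le_min => /andP[? ?]; move: h; rewrite ltr_norml => /andP[? ?].
by apply/andP; split; lra.
Qed.

(** In each coordinate the intervals of radius [2 * aper n] around [e n] meet pairwise, so the
    supremum of their left ends lies in all of them. *)
Lemma nested_unit_vectors (d : nat) (e : nat -> pt d) :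
  (forall m n, (n <= m)%N -> enorm (e n - e m) <= 2 * aper n) -> (forall n, enorm (e n) = 1) ->
  exists2 v, enorm v = 1 & forall n, enorm (e n - v) <= d%:R * (2 * aper n).
Proof.
move=> ecau e1.
have cau n m i : e n ord0 i - 2 * aper n <= e m ord0 i + 2 * aper m.
  have [nm|mn] := leqP n m.
    have := le_trans (coord_le_enorm _ _ i) (ecau m n nm); rewrite !mxE ler_norml => /andP[? ?].
    by have := aper_gt0 m; lra.
  have := le_trans (coord_le_enorm _ _ i) (ecau n m (ltnW mn)).
  rewrite !mxE ler_norml => /andP[? ?].
  by have := aper_gt0 n; lra.
pose E i := range (fun n => e n ord0 i - 2 * aper n).
have Eub i n : ubound (E i) (e n ord0 i + 2 * aper n) by move=> _ [m _ <-]; exact: cau.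
have Esup i : has_sup (E i).
  by split; [exists (e 0%N ord0 i - 2 * aper 0); exists 0%N|exists (e 0%N ord0 i + 2 * aper 0)].
pose v : pt d := \row_i sup (E i).
have ev n : enorm (e n - v) <= d%:R * (2 * aper n).
  apply: enorm_le_coords => i; rewrite !mxE.
  have lo : e n ord0 i - 2 * aper n <= sup (E i).
    by apply: ub_le_sup; [case: (Esup i)|exists n].
  have hi : sup (E i) <= e n ord0 i + 2 * aper n.
    by apply: ge_sup => //; case: (Esup i).
  by rewrite ler_norml; apply/andP; split; lra.
exists v => //; apply/eqP; rewrite -subr_eq0 -normr_eq0 eq_le normr_ge0 andbT.
apply/ler_addgt0Pr => r r0; rewrite add0r.
have [n nr] : exists n, d%:R * (2 * dlt n) <= r.
  exists (Num.truncn (2 * d%:R / r)); rewrite mulrA ler_pdivrMr ?ltr0n // -ler_pdivrMl //.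
  by apply: ltW; rewrite mulrC (mulrC d%:R); exact: truncnS_gt.
apply: le_trans nr; have := enorm_sub_le1 _ v (e n).
rewrite e1 enorm_distC => /le_trans; apply; apply: le_trans (ev n) _.
by rewrite ler_wpM2l ?ler0n // ler_pM2l // aper_le_dlt.
Qed.

Lemma chain_differentiable (d : nat) (g : (nat -> nat) -> pt d) (zs : nat -> state d)
    (f : pt d -> R) :
  (forall s, open_cube d (g s)) -> baire_continuous d g ->
  Lip1 d f -> st_lvl d (zs 0%N) = 0%N ->
  (forall n, [/\ valid d g (zs n), st_U d (zs n) f & follows d g (zs n) (zs n.+1)]) ->
  exists s v, has_gradient d f (g s) v /\ enorm v = 1.
Proof.
move=> gopen gcont lf lvl0 chain.
have lvl n : st_lvl d (zs n) = n.
  by elim: n => // n IH; have [_ _ [-> _ _ _ _]] := chain n; rewrite IH.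
have Smono m n : (n <= m)%N -> st_S d (zs m) `<=` st_S d (zs n).
  elim: m => [|m IH]; first by rewrite leqn0 => /eqP ->.
  rewrite leq_eqVlt => /orP[/eqP->//|]; rewrite ltnS => /IH h.
  by have [_ _ [_ [S'S _] _ _ _]] := chain m; apply: subset_trans S'S h.
have Dmono m n : (n <= m)%N -> st_D d (zs m) `<=` st_D d (zs n).
  elim: m => [|m IH]; first by rewrite leqn0 => /eqP ->.
  rewrite leq_eqVlt => /orP[/eqP->//|]; rewrite ltnS => /IH h.
  by have [_ _ [_ _ D'D _ _]] := chain m; apply: subset_trans D'D h.
have Dne n : exists v, st_D d (zs n) v.
  have [[_ _ [[s Ss] nc] _ _] _ _] := chain n.
  by have [_ ] := not_coverable_nonempty _ _ _ _ (nc s 0%N Ss).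
have [v v1 ev] : exists2 v, enorm v = 1 &
    forall n, enorm (st_e d (zs n) - v) <= d%:R * (2 * aper n).
  apply: nested_unit_vectors; last by move=> n; have [[[_ ->]]] := chain n.
  move=> m n nm; have [u Du] := Dne m.
  have [[_ Dn _ _ _] _ _] := chain n; have [[_ Dm _ _ _] _ _] := chain m.
  have := cone_axes_close _ _ _ _ _ _ (Dn u (Dmono m n nm u Du)) (Dm u Du).
  by rewrite !lvl; have := aper_le n m nm; lra.
have /choice[tau tauS] : forall n, exists s, st_S d (zs n) s.
  by move=> n; have [[_ _ [? _] _ _] _ _] := chain n.
(* Entry [k] is common to all codes from stage [k.+1] on. The limit [sig] need not lie in any
   remaining piece; it suffices that [g sig] lies in all the closures. *)
pose sig k := tau k.+1 k.
have tau_sig m k : (k < m)%N -> tau m k = sig k.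
  move=> km; have [_ _ [_ [_ agree] _ _ _]] := chain k.
  have t1 := Smono m k.+1 km _ (tauS m); have t2 := tauS k.+1.
  by apply: (agree (tau m) (tau k.+1)) => //; rewrite lvl.
have sig_ecl n : ecl d g (st_S d (zs n)) (g sig).
  move=> r r0; have [N hN] := gcont sig r r0.
  exists (tau (maxn n N)); split.
    by apply: (Smono (maxn n N)) (tauS _); exact: leq_maxl.
  rewrite enorm_distC; apply: hN => k kN; apply: tau_sig.
  by apply: leq_trans kN _; exact: leq_maxr.
exists sig, v; split=> // eps eps0.
(* The play controls [f] on the cube only, while the gradient concerns a full neighbourhood. *)
have [w w0 wcube] := open_cube_ball _ _ (gopen sig).
pose al n := st_al d (zs n).
have al0 n : 0 < al n by have [[[]]] := chain n.
have alS n : al n.+1 <= al n / 2 by have [_ _ []] := chain n.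
have aln n : al n * n.+1%:R <= al 0%N.
  elim: n => [|n IH]; first by rewrite mulr1.
  apply: le_trans IH; have := alS n; have := al0 n.
  have : 0 <= n%:R :> R by exact: ler0n.
  by rewrite -[n.+2%:R]natr1 -[n.+1%:R]natr1; nra.
(* 9 comes from the approximation in the play, [2 * d%:R] from replacing the axis of stage [n] by
   the limit [v]. *)
pose N := Num.truncn ((9 + 2 * d%:R) / eps).
have Neps n : (N <= n)%N -> (9 + 2 * d%:R) * dlt n <= eps.
  move=> Nn; rewrite ler_pdivrMr ?ltr0n // [leRHS]mulrC -ler_pdivrMr //.
  by apply: ltW; apply: lt_le_trans (truncnS_gt _) _; rewrite ler_nat ltnS.
exists (Num.min w (al N)); first by rewrite lt_min w0 al0.
move=> y; rewrite lt_min => /andP[yw yal].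
have cy := wcube y yw.
have [y0|yn0] := eqVneq (enorm (y - g sig)) 0.
  rewrite y0 mulr0 (enorm_eq0 _ _ y0) -(scale0r v) dotpZr mul0r subr0.
  by rewrite -[in f y](subrK (g sig) y) (enorm_eq0 _ _ y0) add0r subrr normr0.
have y0 : 0 < enorm (y - g sig) by rewrite lt0r yn0 enorm_ge0.
have exn : exists n, al n <= enorm (y - g sig).
  exists (Num.truncn (al 0%N / enorm (y - g sig))); set n := Num.truncn _.
  rewrite -(@ler_pM2r _ n.+1%:R) ?ltr0n //; apply: le_trans (aln n) _.
  by rewrite mulrC -ler_pdivrMr //; apply: ltW; exact: truncnS_gt.
have almono m n : (m <= n)%N -> al n <= al m.
  elim: n => [|n IH]; first by rewrite leqn0 => /eqP->.
  rewrite leq_eqVlt => /orP[/eqP->//|]; rewrite ltnS => /IH.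
  by have := alS n; have := al0 n; lra.
(* The first scale not above the distance and its predecessor bracket the distance, which selects
   the move to use. *)
case: (ex_minnP exn) => n0 aln0 nmin.
have : (N < n0)%N.
  by rewrite ltnNge; apply/negP => /almono; lra.
case: n0 aln0 nmin => // n aln1 nmin; rewrite ltnS => Nn.
have aln2 : enorm (y - g sig) <= al n.
  by rewrite leNgt; apply/negP => /ltW/nmin; rewrite ltnn.
have [_ _ [_ _ _ _ Q]] := chain n; have [_ Uf _] := chain n.+1.
have aly : al n.+1 <= enorm (y - g sig) <= al n by rewrite aln1.
have := Q f (g sig) y lf Uf (sig_ecl n.+1) cy aly; rewrite lvl => Qn.
have -> : f y - f (g sig) - dotp v (y - g sig) =
    f y - f (g sig) - dotp (st_e d (zs n)) (y - g sig) + dotp (st_e d (zs n) - v) (y - g sig).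
  by rewrite dotpDl dotpNl; ring.
apply: le_trans (ler_normD _ _) _.
have := normr_dotp _ (st_e d (zs n) - v) (y - g sig).
have : enorm (st_e d (zs n) - v) * enorm (y - g sig) <= 2 * d%:R * dlt n * enorm (y - g sig).
  rewrite ler_pM2r //; apply: le_trans (ev n) _.
  rewrite mulrCA mulrA ler_wpM2l ?mulr_ge0 ?ler0n //; exact: aper_le_dlt.
have : (9 + 2 * d%:R) * dlt n * enorm (y - g sig) <= eps * enorm (y - g sig).
  by rewrite ler_pM2r //; exact: Neps.
lra.
Qed.

(** A Lipschitz curve has a nonzero velocity at almost every time, so smallness for all nonzero
    velocities is enough. *)
Lemma coverable_purely_unrectifiable (d : nat) (g : (nat -> nat) -> pt d) :
  coverable d g [set v | 0 < enorm v] setT ->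
  exists P : set (pt d), [/\ Fsigma d P, purely_unrectifiable d P & range g `<=` P].
Proof.
move=> [C [Cp Cc]]; exists (\bigcup_n C n); split.
- by exists C; split=> // n; case: (Cp n).
- move=> gam [lg [c c0 nneg]].
  have nC : (@lebesgue_measure R).-negligible (\bigcup_n (`[0, 1]%classic `&`
      [set t | C n (gam t) /\ exists v, 0 < enorm v /\ curve_deriv d gam t v])).
    by apply: negligible_bigcup => n; have [_ nn] := Cp n; exact: nn.
  apply: negligibleS (negligibleU nneg nC) => t [t01 [n _ Cn]].
  have [[v [gv cv]]|no] := pselect (exists v, curve_deriv d gam t v /\ c <= enorm v).
    right; exists n => //; split=> //; split=> //; exists v; split=> //.
    exact: lt_le_trans cv.
  by left.
- by move=> _ [s _ <-]; have [n Cn] := Cc s I; exists n.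
Qed.

Theorem theorem2p5 (d : nat) (A : set 'rV[R]_d) :
  leq 1 d ->
  A `<=` open_cube d ->
  analytic d A ->
  ~ (exists P : set 'rV[R]_d,
       [/\ Fsigma d P, purely_unrectifiable d P & A `<=` P]) ->
  lip_residual d
    [set f | exists2 x, A x &
       exists v : 'rV[R]_d, has_gradient d f x v /\ enorm v = 1].
Proof.
move=> _ Aopen [A0|[g [gcont Ag]]] ncov.
  exfalso; apply: ncov; exists set0; split; last by rewrite A0.
    exists (fun=> set0); split; last by rewrite bigcup0.
    by move=> _ x /(_ 1 ltr01)[y []].
  by move=> gam _; rewrite preimage_set0 setI0; exact: negligible_set0.
have gopen s : open_cube d (g s) by apply: Aopen; rewrite Ag; exists s.
have gc s : cube d (g s) by move=> i; have /andP[/ltW-> /ltW->] := gopen s i.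
have nc : ~ coverable d g [set v | 0 < enorm v] setT.
  by move=> /coverable_purely_unrectifiable; rewrite -Ag.
have [D [S [e [_ _ e1 Dcone ncS]]]] := narrow_cone _ _ _ _ _ (aper_gt0 0) (fun v h => h) nc.
have ncK := kernel_not_coverable _ _ _ _ ncS.
have [[s0 Ks0] _] := not_coverable_nonempty _ _ _ _ ncK.
pose z0 := State d 0%N setT (kernel d g D S) D e (dlt 0).
apply: (banach_mazur d (state d) (valid d g) (follows d g) (st_U d) z0) => //.
- split=> //=.
  + by split=> //; exact: dlt_gt0.
  + by split; [exists s0|move=> s n; exact: kernel_cyl].
  (* At level 0 the tolerance is [3 * dlt 0 = 3], and the Lipschitz bound already gives 2. *)
  + move=> f lf _ rho rho0; exists (g s0).
      by move=> r r0; exists s0; rewrite subrr enorm0.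
    move=> y _; apply: le_trans (ler_normB _ _) _.
    have := lip_global_clamp d f lf y (g s0); have := normr_dotp _ e (y - g s0).
    have -> : dlt 0 = 1 by rewrite /dlt invr1.
    by rewrite e1; have := enorm_ge0 _ (y - g s0); lra.
  + by move=> h _ _; exists (dlt 0) => //; exact: dlt_gt0.
- by move=> z h [_ _ _ _ zopen]; exact: zopen.
- by move=> z f eta vz lf Uf eta0; exact: game_step.
- move=> f zs lf zs0 chain.
  have lvl0 : st_lvl d (zs 0%N) = 0%N by rewrite zs0.
  have [s [v [fv v1]]] := chain_differentiable _ _ _ _ gopen gcont lf lvl0 chain.
  by exists (g s); [rewrite Ag; exists s|exists v].
Qed.
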